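(* Let $\mathcal X$ be a general state space with a probability measure $\mu$, let $\lambda\in[0,1)$, $\theta>0$, and let $\hat P=(\lambda I+(1-\lambda)\Pi)\otimes I_{d^2}=\lambda I+(1-\lambda)\tilde\Pi$ be a Leon-Perron operator on $L^2(\mu;\mathbb C^{d^2})$. Let $F$ be a function on $\mathcal X$ that is simple $\mu$-almost everywhere, that is, there is a finite set of real symmetric $d\times d$ matrices $\{B_1,\dots,B_m\}$ such that $F^{-1}(B_j)=\{x\in\mathcal X: F(x)=B_j\}$ satisfies $\mu(F^{-1}(B_j))>0$ for all $j\in\{1,\dots,m\}$ and $\sum_{j=1}^m\mu(F^{-1}(B_j))=1$. Assume $aI\preceq B_j\preceq bI$ for all $j$, and let these bounds be tight (i.e. $b$ is the largest and $a$ the smallest among all eigenvalues of the $B_j$). Let $T(x)=\frac12(F(x)\otimes I_d+I_d\otimes F(x))$, and let $E_T^{\theta}$ be the multiplication operator $(E_T^{\theta}\mathbf h)(x)=\exp(\theta T(x))\mathbf h(x)$. Define the matrix-valued function $$\mathcal F(r)=\mathbb E_\mu\left[(1-\lambda)\exp\left(\tfrac\theta2T(x)\right)\left(rI-\lambda\exp(\theta T(x))\right)^{-1}\exp\left(\tfrac\theta2T(x)\right)\right].$$ Then the following hold. (1) Let $r^*$ be such that $\mathcal F(r^* )$ has an eigenvalue of $1$, and let $\mathbf v$ be an eigenvector corresponding to the eigenvalue $1$ of $\mathcal F(r^* )$. Then $r^*$ is an eigenvalue of $E_T^{\theta/2}\hat PE_T^{\theta/2}$ with corresponding eigenfunction $\mathbf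 h$ such that $$\mathbf h(x)=(1-\lambda)\left(r^*I-\lambda\exp(\theta T(x))\right)^{-1}\exp\left(\tfrac\theta2T(x)\right)\mathbf v.$$ Conversely, every eigenvalue of $E_T^{\theta/2}\hat PE_T^{\theta/2}$ is defined this way. (2) Let $\rho$ be the largest eigenvalue of $E_T^{\theta/2}\hat PE_T^{\theta/2}$. Then $\rho>\lambda e^{\theta b}$. (3) $\|E_T^{\theta/2}\hat PE_T^{\theta/2}\|_\mu=\rho$, and $$\lim_{n\to\infty}\frac1n\log\left\langle\mathbf 1\otimes\operatorname{vec}(I_d),\,E_T^{\theta/2}\left(E_T^{\theta/2}\hat PE_T^{\theta/2}\right)^{n-1}E_T^{\theta/2}(\mathbf 1\otimes\operatorname{vec}(I_d))\right\rangle_\mu=\log\rho=\log\left\|E_T^{\theta/2}\hat PE_T^{\theta/2}\right\|_\mu.$$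
   Context: $L^2(\mu;\mathbb C^{d^2})$ is the Hilbert space of measurable $\mathbf h:\mathcal X\to\mathbb C^{d^2}$ with $\mathbb E_\mu\|\mathbf h(x)\|^2<\infty$, with inner product $\langle\mathbf f,\mathbf g\rangle_\mu=\int\langle\mathbf f(x),\mathbf g(x)\rangle\,d\mu(x)$ (standard Euclidean inner product on $\mathbb C^{d^2}$); $\|\cdot\|_\mu$ denotes the corresponding norm and the induced operator norm. $\Pi$ is the projection onto constant functions in the scalar space $L^2(\mu)$, $\Pi h=\mathbb E_\mu[h]\,\mathbf 1$, where $\mathbf 1$ is the constant function $1$, and $\tilde\Pi=\Pi\otimes I_{d^2}$ is its lift, the orthogonal projection onto constant functions in $L^2(\mu;\mathbb C^{d^2})$: $(\tilde\Pi\mathbf h)(x)=\mathbb E_\mu[\mathbf h]$. The symbol $\otimes$ between matrices is the Kronecker product. $\operatorname{vec}(I_d)\in\mathbb C^{d^2}$ is the vectorization of the $d\times d$ identity matrix, and $\mathbf 1\otimes\mathbf v$ denotes the constant function $x\mapsto\mathbf v$.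
   Formalization: In (1) the converse is stated only for eigenvalues r at which rI − λexp(θT(x)) is invertible μ-a.e., so that 𝓕(r) is defined; as written it fails, e.g. F constant on [0,1]: mean-zero functions give the eigenvalue λe^{θb}, where 𝓕 is undefined. *)

(* Defs.v *)
From HB Require Import structures.
From mathcomp Require Import all_boot all_order all_algebra.
From mathcomp Require Import complex mxtens.
From mathcomp Require Import all_classical all_reals all_analysis.

Set Implicit Arguments.
Unset Strict Implicit.
Unset Printing Implicit Defensive.

Import Order.TTheory GRing.Theory Num.Theory.
Import numFieldNormedType.Exports.

Local Open Scope classical_set_scope.
Local Open Scope ring_scope.
Local Open Scope complex_scope.

Section Matrices.
Variable R : realType.

Definition psdmx (n : nat) (A : 'M[R]_n) : Prop :=
  A^T = A /\ forall v : 'cV[R]_n, 0 <= (v^T *m A *m v) 0 0.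

Definition loewner_le (n : nat) (A B : 'M[R]_n) : Prop := psdmx (B - A).

Definition expmx (n : nat) (A : 'M[R]_n) : 'M[R]_n :=
  limn (series (fun k : nat => k`!%:R^-1 *: A ^+ k)).

Definition complexify (m n : nat) (A : 'M[R]_(m, n)) : 'M[R[i]]_(m, n) :=
  map_mx (real_complex R) A.

(* Column-stacking vectorization. The row indexing is the one used by the
   Kronecker product [*t], so that (B^T *t A) *m vec X = vec (A *m X *m B). *)
Definition vec (T : Type) (m n : nat) (A : 'M[T]_(m, n)) : 'cV[T]_(n * m) :=
  \col_k A (mxtens_unindex k).2 (mxtens_unindex k).1.

Definition kron_avg (d : nat) (A : 'M[R]_d) : 'M[R]_(d * d) :=
  2^-1 *: (A *t 1%:M + 1%:M *t A).

Definition cdot (n : nat) (u v : 'cV[R[i]]_n) : R[i] :=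
  \sum_(i < n) (u i 0)^* * v i 0.

End Matrices.

(* Elements of L^2(mu; C^n) are represented by functions, equality being
   mu-almost everywhere equality. *)
Section L2.
Context (dX : measure_display) (X : measurableType dX) (R : realType).
Variable mu : probability X R.

Definition ae_equal (n : nat) (f g : X -> 'cV[R[i]]_n) : Prop :=
  {ae mu, forall x, f x = g x}.

Definition measurable_cfun (n : nat) (h : X -> 'cV[R[i]]_n) : Prop :=
  forall i, measurable_fun setT (fun x => complex.Re (h x i 0)) /\
            measurable_fun setT (fun x => complex.Im (h x i 0)).

(* Membership is invariant under mu-almost everywhere equality: [h] is only
   required to agree almost everywhere with a measurable function. *)
Definition L2 (n : nat) (h : X -> 'cV[R[i]]_n) : Prop :=
  exists g, [/\ measurable_cfun g, ae_equal h g &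
    (\int[mu]_x (complex.Re (cdot (g x) (g x)))%:E < +oo)%E].

Definition Cexpectation (f : X -> R[i]) : R[i] :=
  (\int[mu]_x complex.Re (f x)) +i* (\int[mu]_x complex.Im (f x)).

Definition mxexpectation (m n : nat) (f : X -> 'M[R[i]]_(m, n)) :
    'M[R[i]]_(m, n) :=
  \matrix_(i, j) Cexpectation (fun x => f x i j).

Definition L2inner (n : nat) (f g : X -> 'cV[R[i]]_n) : R[i] :=
  Cexpectation (fun x => cdot (f x) (g x)).

Definition L2norm (n : nat) (f : X -> 'cV[R[i]]_n) : R :=
  Num.sqrt (complex.Re (L2inner f f)).

(* [sup] is 0 on an unbounded set, so a positive value of [L2opnorm Q] entails
   that Q is bounded. *)
Definition L2opnorm (n : nat)
    (Q : (X -> 'cV[R[i]]_n) -> (X -> 'cV[R[i]]_n)) : R :=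
  sup [set L2norm (Q h) | h in [set h | L2 h /\ L2norm h <= 1]].

Definition eigenfunction (n : nat)
    (Q : (X -> 'cV[R[i]]_n) -> (X -> 'cV[R[i]]_n))
    (r : R[i]) (h : X -> 'cV[R[i]]_n) : Prop :=
  [/\ L2 h, ~ ae_equal h (fun=> 0) & ae_equal (Q h) (fun x => r *: h x)].

Definition op_eigenvalue (n : nat)
    (Q : (X -> 'cV[R[i]]_n) -> (X -> 'cV[R[i]]_n)) (r : R[i]) : Prop :=
  exists h, eigenfunction Q r h.

(* In the order of R[i], r <= rho%:C forces r to be real. *)
Definition largest_eigenvalue (n : nat)
    (Q : (X -> 'cV[R[i]]_n) -> (X -> 'cV[R[i]]_n)) (rho : R) : Prop :=
  op_eigenvalue Q rho%:C /\ forall r, op_eigenvalue Q r -> r <= rho%:C.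

Definition const_proj (f : X -> R[i]) : X -> R[i] := fun=> Cexpectation f.

Definition tensor_id (n : nat) (Q : (X -> R[i]) -> (X -> R[i])) :
    (X -> 'cV[R[i]]_n) -> (X -> 'cV[R[i]]_n) :=
  fun h x => \col_i Q (fun y => h y i 0) x.

Definition leon_perron (n : nat) (lam : R) :
    (X -> 'cV[R[i]]_n) -> (X -> 'cV[R[i]]_n) :=
  tensor_id (fun f x => lam%:C * f x + (1 - lam)%:C * const_proj f x).

Definition mulop (n : nat) (M : X -> 'M[R[i]]_n) :
    (X -> 'cV[R[i]]_n) -> (X -> 'cV[R[i]]_n) :=
  fun h x => M x *m h x.

Section Perturbed.
Variables (d : nat) (F : X -> 'M[R]_d).

Definition expT (theta : R) (x : X) : 'M[R[i]]_(d * d) :=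
  complexify (expmx (theta *: kron_avg (F x))).

Definition perturbed_op (lam theta : R) :
    (X -> 'cV[R[i]]_(d * d)) -> (X -> 'cV[R[i]]_(d * d)) :=
  mulop (expT (theta / 2)) \o leon_perron lam \o mulop (expT (theta / 2)).

Definition resolvent_mx (lam theta : R) (r : R[i]) (x : X) :
    'M[R[i]]_(d * d) :=
  r%:M - lam%:C *: expT theta x.

(* [invmx] is the identity on singular matrices, so the two definitions after
   this one are meaningful only when [calF_defined] holds. *)
Definition calF_defined (lam theta : R) (r : R[i]) : Prop :=
  {ae mu, forall x, resolvent_mx lam theta r x \in unitmx}.

Definition calF (lam theta : R) (r : R[i]) : 'M[R[i]]_(d * d) :=
  mxexpectation (fun x => (1 - lam)%:C *:
    (expT (theta / 2) x *m invmx (resolvent_mx lam theta r x)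
       *m expT (theta / 2) x)).

Definition calF_eigenfunction (lam theta : R) (r : R[i])
    (v : 'cV[R[i]]_(d * d)) : X -> 'cV[R[i]]_(d * d) :=
  fun x => (1 - lam)%:C *:
    (invmx (resolvent_mx lam theta r x) *m (expT (theta / 2) x *m v)).

Definition ae_simple (m : nat) (B : 'I_m -> 'M[R]_d) : Prop :=
  [/\ injective B,
      forall j, (B j)^T = B j,
      forall j, measurable (F @^-1` [set B j]),
      forall j, (0 < mu (F @^-1` [set B j]))%E &
      (\sum_(j < m) mu (F @^-1` [set B j]) = 1)%E].

End Perturbed.

End L2.

Definition tight_bounds (R : realType) (d m : nat) (B : 'I_m -> 'M[R]_d)
    (a b : R) : Prop :=
  [/\ exists j, eigenvalue (B j) a, exists j, eigenvalue (B j) b &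
      forall j c, eigenvalue (B j) c -> a <= c <= b].

(* Main.v *)
Require Import Defs.
From HB Require Import structures.
From mathcomp Require Import all_boot all_order all_algebra.
From mathcomp Require Import complex mxtens spectral.
From mathcomp Require Import all_classical all_reals all_analysis.
From mathcomp Require Import measurable_realfun ring lra.

(* On a cell F = B_j the operator acts as
     (A h)(x) = lam S_j^2 h(x) + (1 - lam) S_j E[S h],  S_j = exp(theta T_j / 2),
   so h is an eigenfunction for r iff (r - lam S_j^2) h(x) = (1 - lam) S_j v with
   v = E[S h]; taking E[S .] turns this into calF(r) v = v, which is (1).

   On functions constant on the cells, A is a real symmetric positive matrix [cell_op],
   and rho is its largest eigenvalue. Testing the Rayleigh quotient of [cell_op] on one
   cell gives rho > lam e^(theta b). An eigenvalue of A outside the spectra of the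
   lam S_j^2 has, by (1), an eigenfunction constant on the cells, so rho is the largest
   eigenvalue. The norm bound |A h| <= rho |h| passes from cell means to h by convexity
   of y |-> rho^2 |y|^2 - |lam S_j^2 y + e|^2.

   For the growth rate, S_j = K_j (x) K_j acts on vectorized matrices by congruence, so
   A preserves the relation "X is dominated by Y", and the starting vector vec(K_j^2) is
   positive definite, hence up to a constant dominates any eigenfunction. Pairing the
   iterates of both yields <g, A^n g> >= c rho^n with c > 0. *)

Import Order.TTheory GRing.Theory Num.Theory.
Import numFieldNormedType.Exports.

Set Implicit Arguments.
Unset Strict Implicit.
Unset Printing Implicit Defensive.

Local Open Scope classical_set_scope.
Local Open Scope ring_scope.
Local Open Scope complex_scope.

(** * Spectral theorem and matrix exponential *)

Section ExpMatrix.
Variable R : realType.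

Lemma complexify_inj m n : injective (@complexify R m n).
Proof. by apply: map_mx_inj; exact: complexI. Qed.

Lemma Re_sum I (r : seq I) (P : pred I) (f : I -> R[i]) :
  complex.Re (\sum_(i <- r | P i) f i) = \sum_(i <- r | P i) complex.Re (f i).
Proof. by apply: (big_morph _ (id1 := 0) (op1 := +%R)) => [[? ?] [? ?]|]. Qed.

Lemma Im_sum I (r : seq I) (P : pred I) (f : I -> R[i]) :
  complex.Im (\sum_(i <- r | P i) f i) = \sum_(i <- r | P i) complex.Im (f i).
Proof. by apply: (big_morph _ (id1 := 0) (op1 := +%R)) => [[? ?] [? ?]|]. Qed.

Lemma ReMr (x : R[i]) (y : R) : complex.Re (x * y%:C) = complex.Re x * y.
Proof. by case: x => a b /=; rewrite mulr0 subr0. Qed.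

Lemma ImMr (x : R[i]) (y : R) : complex.Im (x * y%:C) = complex.Im x * y.
Proof. by case: x => a b /=; rewrite mulr0 add0r. Qed.

(** Obtained by viewing [A] as a Hermitian matrix over [R[i]]. The unitary change of basis may be
    complex, but the spectrum is real and is returned as a real row. *)
Lemma symmetric_spectral n (A : 'M[R]_n) : A^T = A ->
  exists P Q : 'M[R[i]]_n, exists D : 'rV[R]_n,
    [/\ P *m Q = 1%:M, Q *m P = 1%:M,
        forall i j, Q i j = (P j i)^*%C &
        complexify A = Q *m diag_mx (complexify D) *m P].
Proof.
move=> symA.
have Ah : complexify A \is hermsymmx.
  apply: realsym_hermsym.
    apply/is_hermitianmxP; rewrite expr0 scale1r map_mx_id //.
    by rewrite /complexify map_trmx symA.
  by apply/mxOverP => i j; rewrite mxE; apply/complex_realP; exists (A i j).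
have /hermitian_normalmx/orthomx_spectralP := Ah.
set P := spectralmx _; set D := spectral_diag _ => AE.
have uP : P \is unitarymx by exact: spectral_unitarymx.
have /mxOverP realD : D \is a realmx by exact: hermitian_spectral_diag_real.
exists P, (invmx P), (\row_j complex.Re (D 0 j)).
have Pu : P \in unitmx by exact: unitarymx_unit.
split; [exact: mulmxV|exact: mulVmx| |].
  by move=> i j; rewrite invmx_unitary // !mxE.
rewrite AE; congr (_ *m diag_mx _ *m _); apply/rowP => j.
by rewrite !mxE [RHS]RRe_real.
Qed.

Lemma cvg_mx_entries m n (f : nat -> 'M[R]_(m, n)) (M : 'M[R]_(m, n)) :
  (forall i j, (fun k => f k i j) @ \oo --> M i j) -> f @ \oo --> M.
Proof.
move=> fM A [P MP PA].
have : \forall k \near \oo, forall ij : 'I_m * 'I_n, P ij.1 ij.2 (f k ij.1 ij.2).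
  by apply: filter_forall => -[i j]; exact: fM (MP i j).
by apply: filterS => k Pk; apply: PA => i j; exact: Pk (i, j).
Qed.

(** The exponential series is diagonalized term by term, which leaves scalar exponential series. Its
    limit is taken among real matrices while [P] and [Q] are complex, so real and imaginary parts
    are treated separately. *)
Lemma complexify_spectral_expmx n (A : 'M[R]_n) (P Q : 'M[R[i]]_n) (D : 'rV[R]_n) :
  P *m Q = 1%:M -> Q *m P = 1%:M ->
  complexify A = Q *m diag_mx (complexify D) *m P ->
  complexify (expmx A) = Q *m diag_mx (complexify (map_mx expR D)) *m P.
Proof.
move=> PQ QP AE.
have QdPE (d : 'rV[R]_n) i j : (Q *m diag_mx (complexify d) *m P) i j =
    \sum_l Q i l * P l j * (d 0 l)%:C.
  by rewrite mul_mx_diag !mxE; apply: eq_bigr => l _; rewrite !mxE mulrAC.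
have powE k : complexify (A ^+ k) =
    Q *m diag_mx (complexify (map_mx (fun x => x ^+ k) D)) *m P.
  elim: k => [|k IH].
    rewrite /complexify map_mx1 -QP; apply/matrixP => i j.
    by rewrite QdPE !mxE; apply: eq_bigr => l _; rewrite !mxE mulr1.
  rewrite exprS -[_ * _]/(_ *m _) /complexify map_mxM -!/(complexify _) IH AE.
  rewrite !mulmxA -(mulmxA _ P Q) PQ mulmx1 -(mulmxA Q) mulmx_diag.
  congr (_ *m diag_mx _ *m _); apply/rowP => l.
  by rewrite !mxE -rmorphM exprS.
have sumE N i j : ((series (fun k : nat => k`!%:R^-1 *: A ^+ k) N) i j)%:C =
    \sum_l Q i l * P l j * (series (exp_coeff (D 0 l)) N)%:C.
  rewrite !seriesEnat /= summxE rmorph_sum /=.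
  under [RHS]eq_bigr do rewrite seriesEnat /= rmorph_sum mulr_sumr.
  rewrite exchange_big /=; apply: eq_bigr => k _.
  have /matrixP/(_ i j) := powE k; rewrite QdPE mxE => AkE.
  rewrite mxE rmorphM /= AkE mulr_sumr; apply: eq_bigr => l _.
  rewrite !mxE /exp_coeff /= rmorphM /= mulrCA; congr (_ * _).
  by rewrite mulrC.
(* With [e] the real part, [L] gives the entries of the partial sums and of their limit. With [e]
   the imaginary part it vanishes on every partial sum, hence also in the limit. *)
pose L (e : R[i] -> R) i j (d : 'rV[R]_n) : R := \sum_l e (Q i l * P l j) * d 0 l.
have cvgL e i j : (fun N => L e i j (\row_l series (exp_coeff (D 0 l)) N)) @ \oo -->
    L e i j (map_mx expR D).
  apply: cvg_big => [|l _]; first exact: add_continuous.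
  rewrite mxE; under eq_fun do rewrite mxE.
  apply: cvgM; first exact: cvg_cst.
  exact: (is_cvg_series_exp_coeff (D 0 l)).
have cvgRe : series (fun k : nat => k`!%:R^-1 *: A ^+ k) @ \oo -->
    (\matrix_(i, j) L (@complex.Re R) i j (map_mx expR D) : 'M[R]_n).
  apply: cvg_mx_entries => i j; rewrite mxE.
  rewrite (_ : (fun _ => _) =
      fun N => L (@complex.Re R) i j (\row_l series (exp_coeff (D 0 l)) N)) //.
  apply/funext => N; rewrite -[LHS]/(complex.Re (_%:C)) sumE Re_sum.
  by apply: eq_bigr => l _; rewrite mxE ReMr.
have expE : expmx A = \matrix_(i, j) L (@complex.Re R) i j (map_mx expR D).
  by apply/cvg_lim => //; exact: norm_hausdorff.
apply/matrixP => i j; rewrite QdPE [LHS]mxE expE mxE.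
apply/eqP; rewrite eq_complex /= Re_sum Im_sum; apply/andP; split; apply/eqP.
  by apply: eq_bigr => l _; rewrite ReMr.
under eq_bigr do rewrite ImMr.
rewrite -/(L (@complex.Im R) i j (map_mx expR D)).
have /cvg_lim <- // := cvgL (@complex.Im R) i j.
rewrite (_ : (fun _ => _) = cst 0) ?lim_cst //.
apply/funext => N /=; rewrite -[RHS](_ : complex.Im (series
  (fun k : nat => k`!%:R^-1 *: A ^+ k) N i j)%:C = 0) // sumE Im_sum.
by apply: eq_bigr => l _; rewrite mxE ImMr.
Qed.

Lemma spectral_scale n (A : 'M[R]_n) (P Q : 'M[R[i]]_n) (D : 'rV[R]_n) s :
  complexify A = Q *m diag_mx (complexify D) *m P ->
  complexify (s *: A) = Q *m diag_mx (complexify (s *: D)) *m P.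
Proof.
by rewrite /complexify !map_mxZ linearZ /= -scalemxAr -scalemxAl => ->.
Qed.

Lemma expmxD n (A : 'M[R]_n) s t : A^T = A ->
  expmx (s *: A) *m expmx (t *: A) = expmx ((s + t) *: A).
Proof.
move=> /symmetric_spectral[P [Q [D [PQ QP _ AE]]]]; apply: complexify_inj.
have E r := complexify_spectral_expmx PQ QP (spectral_scale r AE).
rewrite {1}/complexify map_mxM -!/(complexify _) !E.
rewrite !mulmxA -(mulmxA _ P Q) PQ mulmx1 -(mulmxA Q) mulmx_diag.
congr (_ *m diag_mx _ *m _); apply/rowP => l.
by rewrite !mxE mulrDl expRD -rmorphM.
Qed.

Lemma expmx0 n : expmx (0 : 'M[R]_n) = 1%:M.
Proof.
apply: complexify_inj; rewrite (@complexify_spectral_expmx _ _ 1%:M 1%:M 0) ?mulmx1 //.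
  by rewrite mul1mx; apply/matrixP => i j; rewrite !mxE expR0 /= rmorphMn.
by rewrite mul1mx; apply/matrixP => i j; rewrite !mxE mul0rn.
Qed.

Lemma expmx_half n (A : 'M[R]_n) s : A^T = A ->
  expmx ((s / 2) *: A) *m expmx ((s / 2) *: A) = expmx (s *: A).
Proof. by move=> /expmxD ->; rewrite -splitr. Qed.

Lemma expmx_unit n (A : 'M[R]_n) : A^T = A -> expmx A \in unitmx.
Proof.
move=> symA; apply: (@mulmx1_unit _ _ _ (expmx (- 1 *: A)) _).1.
by rewrite -{1}(scale1r A) expmxD // subrr scale0r expmx0.
Qed.

(** [Q] is the conjugate transpose of [P] and the exponentiated spectrum is real, so the exponential
    is Hermitian; being real, it is symmetric. *)
Lemma tr_expmx n (A : 'M[R]_n) : A^T = A -> (expmx A)^T = expmx A.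
Proof.
move=> /symmetric_spectral[P [Q [D [PQ QP QE AE]]]]; apply: complexify_inj.
have E := complexify_spectral_expmx PQ QP AE.
rewrite {1}/complexify -map_trmx -/(complexify _).
have cM (x y : R[i]) : (x * y)^*%C = x^*%C * y^*%C by exact: rmorphM.
have cS (f : 'I_n -> R[i]) : (\sum_l f l)^*%C = \sum_l (f l)^*%C.
  exact: rmorph_sum.
have EE : complexify (expmx A) = (map_mx (@conjc R) (complexify (expmx A)))^T.
  rewrite E; apply/matrixP => i j; rewrite mul_mx_diag !mxE cS.
  apply: eq_bigr => l _; rewrite !mxE !cM conjc_real !QE conjcK.
  ring.
rewrite {1}EE trmxK -map_mx_comp; apply: eq_map_mx => x.
by rewrite /= -[LHS]/((x%:C)^*%C) conjc_real.
Qed.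

(** In the eigenbasis, the coordinates of [v] vanish wherever the spectrum differs from [c]; on the
    others the exponential multiplies by e^c. *)
Lemma expmx_eigen n (A : 'M[R]_n) c (v : 'cV[R]_n) : A^T = A ->
  A *m v = c *: v -> expmx A *m v = expR c *: v.
Proof.
move=> /symmetric_spectral[P [Q [D [PQ QP _ AE]]]] Av; apply: complexify_inj.
have E := complexify_spectral_expmx PQ QP AE.
pose w := P *m complexify v.
have Dw : diag_mx (complexify D) *m w = c%:C *: w.
  have : P *m complexify (A *m v) = c%:C *: w.
    by rewrite Av /complexify map_mxZ -scalemxAr.
  by rewrite {1}/complexify map_mxM -/(complexify _) AE !mulmxA PQ mul1mx -mulmxA.
rewrite /complexify map_mxM map_mxZ -!/(complexify _) E -mulmxA.
have -> : complexify v = Q *m w by rewrite mulmxA QP mul1mx.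
rewrite -[LHS]mulmxA -/w (mulmxA P) PQ mul1mx.
have -> : diag_mx (complexify (map_mx expR D)) *m w = (expR c)%:C *: w.
  apply/colP => l; rewrite mul_diag_mx !mxE.
  have /colP/(_ l) := Dw; rewrite mul_diag_mx !mxE.
  set z := \sum_j _.
  have [->|z0 /mulIf] := eqVneq z 0; first by rewrite !mulr0.
  by move=> /(_ z0)/complexI ->.
by rewrite -scalemxAr.
Qed.

Lemma tens_diag_mx (T : comPzRingType) m n (a : 'rV[T]_m) (b : 'rV[T]_n) :
  diag_mx a *t diag_mx b =
  diag_mx (\row_k (a 0 (mxtens_unindex k).1 * b 0 (mxtens_unindex k).2)).
Proof.
apply/matrixP => i j; rewrite !mxE -(can_eq (@mxtens_unindexK m n)) xpair_eqE.
by case: eqP; case: eqP => _ _; rewrite ?mulr0n ?mul0r ?mulr0.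
Qed.

Lemma tens_scalar_mx1 (T : comPzRingType) m n :
  1%:M *t 1%:M = 1%:M :> 'M[T]_(m * n).
Proof.
rewrite -!diag_const_mx tens_diag_mx; congr diag_mx.
by apply/rowP => k; rewrite !mxE mulr1.
Qed.

Lemma tr_kron_avg n (A : 'M[R]_n) : A^T = A -> (kron_avg A)^T = kron_avg A.
Proof.
by move=> AT; rewrite /kron_avg linearZ linearD /= !trmx_tens trmx1 AT.
Qed.

(** If [P] diagonalizes [A] with spectrum D, then [P *t P] diagonalizes [kron_avg A] with spectrum
    (D_i + D_j) / 2, and the exponential of this sum factors. *)
Lemma expmx_kron_avg n (A : 'M[R]_n) s : A^T = A ->
  expmx (s *: kron_avg A) = expmx ((s / 2) *: A) *t expmx ((s / 2) *: A).
Proof.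
move=> /symmetric_spectral[P [Q [D [PQ QP _ AE]]]]; apply: complexify_inj.
have E r := complexify_spectral_expmx PQ QP (spectral_scale r AE).
rewrite [RHS]map_mxT -!/(complexify _) E -!tensmx_mul tens_diag_mx.
pose d := \row_k ((s / 2) * (D 0 (@mxtens_unindex n n k).1
                             + D 0 (@mxtens_unindex n n k).2)).
rewrite (@complexify_spectral_expmx _ _ (P *t P) (Q *t Q) d); first last.
- have -> : diag_mx (complexify d) = (s / 2)%:C *:
      (diag_mx (complexify D) *t 1%:M + 1%:M *t diag_mx (complexify D)).
    rewrite -diag_const_mx !tens_diag_mx -linearD -linearZ /=; congr diag_mx.
    by apply/rowP => k; rewrite !mxE mulr1 mul1r -rmorphD -rmorphM.
  rewrite -scalemxAr -scalemxAl.
  rewrite mulmxDr mulmxDl !tensmx_mul !mulmx1 QP -AE.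
  rewrite /complexify /kron_avg map_mxZ map_mxZ map_mxD !map_mxT map_mx1 scalerA.
  by rewrite -rmorphM.
- by rewrite tensmx_mul QP tens_scalar_mx1.
- by rewrite tensmx_mul PQ tens_scalar_mx1.
congr (_ *m diag_mx _ *m _); apply/rowP => k; rewrite !mxE -rmorphM -expRD.
by rewrite mulrDr.
Qed.

(** * Real inner product and quadratic forms *)

Definition dotv n (u v : 'cV[R]_n) : R := (u^T *m v) 0 0.

Lemma dotvE n (u v : 'cV[R]_n) : dotv u v = \sum_a u a 0 * v a 0.
Proof. by rewrite /dotv mxE; apply: eq_bigr => a _; rewrite mxE. Qed.

Lemma dotvC n (u v : 'cV[R]_n) : dotv u v = dotv v u.
Proof. by rewrite !dotvE; apply: eq_bigr => a _; rewrite mulrC. Qed.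

Lemma dotvDr n (u v w : 'cV[R]_n) : dotv u (v + w) = dotv u v + dotv u w.
Proof. by rewrite /dotv mulmxDr mxE. Qed.

Lemma dotvDl n (u v w : 'cV[R]_n) : dotv (u + v) w = dotv u w + dotv v w.
Proof. by rewrite dotvC dotvDr !(dotvC w). Qed.

Lemma dotvZr n c (u v : 'cV[R]_n) : dotv u (c *: v) = c * dotv u v.
Proof. by rewrite /dotv -scalemxAr mxE. Qed.

Lemma dotvZl n c (u v : 'cV[R]_n) : dotv (c *: u) v = c * dotv u v.
Proof. by rewrite dotvC dotvZr dotvC. Qed.

Lemma dotvNr n (u v : 'cV[R]_n) : dotv u (- v) = - dotv u v.
Proof. by rewrite -scaleN1r dotvZr mulN1r. Qed.

Lemma dotvNl n (u v : 'cV[R]_n) : dotv (- u) v = - dotv u v.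
Proof. by rewrite -scaleN1r dotvZl mulN1r. Qed.

Lemma dotv0r n (u : 'cV[R]_n) : dotv u 0 = 0.
Proof. by rewrite /dotv mulmx0 mxE. Qed.

Lemma dotv_sumr n (I : finType) (u : 'cV[R]_n) (f : I -> 'cV[R]_n) :
  dotv u (\sum_i f i) = \sum_i dotv u (f i).
Proof. by rewrite /dotv mulmx_sumr summxE. Qed.

Lemma dotv_ge0 n (u : 'cV[R]_n) : 0 <= dotv u u.
Proof. by rewrite dotvE sumr_ge0 // => a _; rewrite -expr2 sqr_ge0. Qed.

Lemma dotv_eq0 n (u : 'cV[R]_n) : (dotv u u == 0) = (u == 0).
Proof.
apply/idP/eqP => [|->]; last by rewrite dotv0r.
rewrite dotvE psumr_eq0 => [/allP u0|a _]; last by rewrite -expr2 sqr_ge0.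
apply/colP => a; have := u0 a (mem_index_enum _).
by rewrite mulf_eq0 orbb mxE => /eqP.
Qed.

Lemma dotv_gt0 n (u : 'cV[R]_n) : u != 0 -> 0 < dotv u u.
Proof. by move=> u0; rewrite lt_neqAle eq_sym dotv_eq0 u0 dotv_ge0. Qed.

Lemma dotv_mulmx m n (A : 'M[R]_(m, n)) u v : dotv u (A *m v) = dotv (A^T *m u) v.
Proof. by rewrite /dotv trmx_mul trmxK mulmxA. Qed.

Lemma dotv_sym n (A : 'M[R]_n) u v : A^T = A -> dotv u (A *m v) = dotv (A *m u) v.
Proof. by rewrite dotv_mulmx => ->. Qed.

(* Adding the nonnegative quantities [<z, A z>] at [z = rho y - A y] and
   [<A y, (rho - A) A y>] gives [|A y|^2 <= rho <y, A y>]. *)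
Lemma psd_norm_le n (A : 'M[R]_n) (rho : R) : A^T = A -> 0 < rho ->
  (forall y, 0 <= dotv y (A *m y)) ->
  (forall y, dotv y (A *m y) <= rho * dotv y y) ->
  forall y, dotv (A *m y) (A *m y) <= rho ^+ 2 * dotv y y.
Proof.
move=> symA rho0 A_ge0 A_le y.
have := A_ge0 (rho *: y - A *m y); have := A_le (A *m y); have := A_le y.
rewrite mulmxBr -scalemxAr !(dotvDl, dotvDr, dotvNl, dotvNr, dotvZl, dotvZr).
rewrite (dotv_sym y (A *m y) symA).
set a := dotv (A *m y) (A *m y); set b := dotv y (A *m y); set c := dotv y y.
set e := dotv (A *m y) (A *m (A *m y)) => bc ea H.
have {}H : 0 <= rho * (rho * b - a) by lra.
rewrite (pmulr_rge0 _ rho0) in H.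
have : rho * b <= rho * (rho * c) by rewrite ler_pM2l.
by rewrite expr2 -mulrA; lra.
Qed.

(** * Real and imaginary parts; eigenvalues of real symmetric matrices *)

Lemma ReZl (x : R) (y : R[i]) : complex.Re (x%:C * y) = x * complex.Re y.
Proof. by rewrite mulrC ReMr mulrC. Qed.

Lemma ImZl (x : R) (y : R[i]) : complex.Im (x%:C * y) = x * complex.Im y.
Proof. by rewrite mulrC ImMr mulrC. Qed.

Definition Remx m n (v : 'M[R[i]]_(m, n)) : 'M[R]_(m, n) := map_mx (@complex.Re R) v.
Definition Immx m n (v : 'M[R[i]]_(m, n)) : 'M[R]_(m, n) := map_mx (@complex.Im R) v.

Lemma Remx_mul m n p (A : 'M[R]_(m, n)) (v : 'M[R[i]]_(n, p)) :
  Remx (complexify A *m v) = A *m Remx v.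
Proof.
by apply/matrixP => i j; rewrite !mxE Re_sum; apply: eq_bigr => k _; rewrite !mxE ReZl.
Qed.

Lemma Immx_mul m n p (A : 'M[R]_(m, n)) (v : 'M[R[i]]_(n, p)) :
  Immx (complexify A *m v) = A *m Immx v.
Proof.
by apply/matrixP => i j; rewrite !mxE Im_sum; apply: eq_bigr => k _; rewrite !mxE ImZl.
Qed.

Lemma RemxD m n (u v : 'M[R[i]]_(m, n)) : Remx (u + v) = Remx u + Remx v.
Proof. by apply/matrixP => i j; rewrite !mxE; case: (u i j) (v i j) => ? ? []. Qed.

Lemma ImmxD m n (u v : 'M[R[i]]_(m, n)) : Immx (u + v) = Immx u + Immx v.
Proof. by apply/matrixP => i j; rewrite !mxE; case: (u i j) (v i j) => ? ? []. Qed.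

Lemma RemxZ m n r (v : 'M[R[i]]_(m, n)) :
  Remx (r *: v) = complex.Re r *: Remx v - complex.Im r *: Immx v.
Proof. by apply/matrixP => i j; rewrite !mxE; case: r (v i j) => ? ? []. Qed.

Lemma ImmxZ m n r (v : 'M[R[i]]_(m, n)) :
  Immx (r *: v) = complex.Re r *: Immx v + complex.Im r *: Remx v.
Proof. by apply/matrixP => i j; rewrite !mxE; case: r (v i j) => ? ? []. Qed.

Lemma RemxZr m n r (v : 'M[R[i]]_(m, n)) : Remx (r%:C *: v) = r *: Remx v.
Proof. by rewrite RemxZ scale0r subr0. Qed.

Lemma ImmxZr m n r (v : 'M[R[i]]_(m, n)) : Immx (r%:C *: v) = r *: Immx v.
Proof. by rewrite ImmxZ scale0r addr0. Qed.

Lemma Remx_sum (I : finType) m n (f : I -> 'M[R[i]]_(m, n)) :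
  Remx (\sum_i f i) = \sum_i Remx (f i).
Proof.
by apply/matrixP => i j; rewrite mxE !summxE Re_sum; apply: eq_bigr => l _; rewrite mxE.
Qed.

Lemma Immx_sum (I : finType) m n (f : I -> 'M[R[i]]_(m, n)) :
  Immx (\sum_i f i) = \sum_i Immx (f i).
Proof.
by apply/matrixP => i j; rewrite mxE !summxE Im_sum; apply: eq_bigr => l _; rewrite mxE.
Qed.

Lemma ReImmx_eq m n (u v : 'M[R[i]]_(m, n)) :
  Remx u = Remx v -> Immx u = Immx v -> u = v.
Proof.
move=> /matrixP re /matrixP im; apply/matrixP => i j.
by apply/eqP; rewrite eq_complex; move: (re i j) (im i j); rewrite !mxE => -> ->; rewrite !eqxx.
Qed.

Lemma ReImmx_neq0 m n (v : 'M[R[i]]_(m, n)) : v != 0 -> Remx v != 0 \/ Immx v != 0.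
Proof.
move=> v0; have [re0|] := eqVneq (Remx v) 0; last by left.
have [im0|] := eqVneq (Immx v) 0; last by right.
case/eqP: v0; apply: ReImmx_eq; rewrite ?re0 ?im0;
  by apply/matrixP => i j; rewrite !mxE.
Qed.

(** Write v = x + iy and r = s + it. Symmetry of [A] tested on x and y gives t (|x|^2 + |y|^2) = 0,
    so [r] is real; adding the bounds at x and y then gives s <= rho. *)
Lemma symmetric_eigenvalue_le n (A : 'M[R]_n) (rho : R) r (v : 'cV[R[i]]_n) : A^T = A ->
  (forall y, dotv y (A *m y) <= rho * dotv y y) ->
  v != 0 -> complexify A *m v = r *: v -> r <= rho%:C.
Proof.
move=> symA A_le v0 Av.
have := congr1 (@Remx _ _) Av; rewrite Remx_mul RemxZ => Ax.
have := congr1 (@Immx _ _) Av; rewrite Immx_mul ImmxZ => Ay.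
case: r Av Ax Ay => s t /= _ Ax Ay.
have := A_le (Immx v); have := A_le (Remx v); have := dotv_sym (Remx v) (Immx v) symA.
rewrite Ax Ay !(dotvDl, dotvDr, dotvNl, dotvNr, dotvZl, dotvZr) (dotvC (Immx v)).
set c := dotv (Remx v) (Immx v); set a := dotv (Remx v) _; set b := dotv (Immx v) _.
have a0 : 0 <= a by exact: dotv_ge0.
have b0 : 0 <= b by exact: dotv_ge0.
have ab0 : 0 < a + b.
  by case: (ReImmx_neq0 v0) => /dotv_gt0; rewrite -?/a -?/b => ?; lra.
move=> H.
have t0 : t = 0.
  have /eqP : t * (a + b) = 0 by lra.
  by rewrite mulf_eq0 (gt_eqF ab0) orbF => /eqP.
rewrite t0 => Ha Hb; rewrite lecE /= eqxx /=.
have : s * (a + b) <= rho * (a + b) by lra.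
by rewrite ler_pM2r.
Qed.

Lemma symmetric_top_eigenvector n (A : 'M[R]_n.+1) : A^T = A ->
  exists (rho : R) (x : 'cV[R]_n.+1), [/\ x != 0, A *m x = rho *: x &
    forall y, dotv y (A *m y) <= rho * dotv y y].
Proof.
move=> /symmetric_spectral[P [Q [D [PQ QP QE AE]]]].
pose l0 := [arg max_(l > ord0) D 0 l]%O.
have Dmax l : D 0 l <= D 0 l0.
  by rewrite /l0; case: (@Order.TotalTheory.arg_maxP _ _ _ ord0 xpredT) => //= i _; apply.
pose z : 'cV_n.+1 := Q *m delta_mx l0 0.
have z0 : z != 0.
  apply/eqP => /(congr1 (mulmx P)); rewrite mulmxA PQ mul1mx mulmx0.
  by move/matrixP/(_ l0 0); rewrite !mxE !eqxx => /eqP; rewrite oner_eq0.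
have Az : complexify A *m z = (D 0 l0)%:C *: z.
  rewrite AE /z !mulmxA -(mulmxA _ P Q) PQ mulmx1 -mulmxA scalemxAr.
  congr (_ *m _); apply/colP => l; rewrite mul_diag_mx !mxE andbT.
  by case: eqP => [->|]; rewrite ?mulr0.
(* [A] and the eigenvalue are real, so the real and imaginary parts of the complex eigenvector [z]
   both satisfy the equation, and one of them is nonzero. *)
have : exists2 x : 'cV[R]_n.+1, x != 0 & A *m x = D 0 l0 *: x.
  case: (ReImmx_neq0 z0) => [re|im]; [exists (Remx z)|exists (Immx z)] => //.
    by rewrite -Remx_mul Az RemxZr.
  by rewrite -Immx_mul Az ImmxZr.
case=> x x0 Ax; exists (D 0 l0), x; split=> // y.
pose w := P *m complexify y.
(* Squared modulus of the [l]-th coordinate of [y] in the eigenbasis; the quadratic forms of [A] and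
   of the identity become sums weighted by it. *)
pose nw l := complex.Re ((w l 0)^*%C * w l 0).
have nw_ge0 l : 0 <= nw l by rewrite /nw; case: (w l 0) => a b /=; nra.
have wTE : (complexify y)^T *m Q = (map_mx (@conjc R) w)^T.
  apply/rowP => l; rewrite !mxE (_ : conjc _ = \sum_j (P l j)^*%C * (complexify y j 0)^*%C).
    apply: eq_bigr => j _; rewrite !mxE QE mulrC; congr (_ * _).
    by rewrite -[in RHS](conjc_real (y j 0)) conjcK.
  by rewrite (rmorph_sum (@conjc R)); apply: eq_bigr => j _; exact: rmorphM.
have quadE (d : 'rV[R]_n.+1) :
    complex.Re (((complexify y)^T *m (Q *m diag_mx (complexify d) *m P) *m complexify y) 0 0)
    = \sum_l d 0 l * nw l.
  rewrite -!mulmxA -/w mulmxA wTE mxE Re_sum; apply: eq_bigr => l _.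
  by rewrite /nw; move: (w) => u; rewrite mul_diag_mx !mxE -ReZl mulrCA.
have quadR (M : 'M[R]_n.+1) d : complexify M = Q *m diag_mx (complexify d) *m P ->
    dotv y (M *m y) = \sum_l d 0 l * nw l.
  move=> ME; rewrite -quadE -ME /complexify map_trmx -!map_mxM -mulmxA.
  by rewrite [in RHS]mxE.
have -> : dotv y y = \sum_l nw l.
  have := quadR 1%:M (const_mx 1); rewrite mul1mx => ->; first last.
    rewrite [complexify (const_mx _)]map_const_mx diag_const_mx mulmx1 QP.
    by rewrite /complexify map_mx1.
  by apply: eq_bigr => l _; rewrite mxE mul1r.
rewrite (quadR _ _ AE).
by rewrite mulr_sumr; apply: ler_sum => l _; rewrite ler_wpM2r.
Qed.

End ExpMatrix.

(** * The operator on functions constant on the cells *)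

Section FiniteModel.
Variables (R : realType) (m n : nat) (p : 'I_m -> R) (S : 'I_m -> 'M[R]_n) (lam : R).
Hypothesis p_gt0 : forall j, 0 < p j.
Hypothesis symS : forall j, (S j)^T = S j.
Hypothesis lam_ge0 : 0 <= lam.
Hypothesis lam_lt1 : lam < 1.

Implicit Types k l : 'I_m -> 'cV[R]_n.

(** For h equal to [k j] on the cell F = B_j of probability [p j], this is E[S h]; [cell_op] and
    [cell_dot] are then the operator and the L^2 inner product. *)
Definition cell_avg k : 'cV[R]_n := \sum_j p j *: (S j *m k j).

Definition cell_op k : 'I_m -> 'cV[R]_n := fun i =>
  lam *: (S i *m (S i *m k i)) + (1 - lam) *: (S i *m cell_avg k).

Definition cell_dot k l : R := \sum_i p i * dotv (k i) (l i).

(** The weights sqrt(p_i) turn [cell_dot] into the Euclidean inner product, so that [cell_op],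
    self-adjoint for the weighted product, becomes the symmetric matrix [cell_mx]. *)
Let stack k : 'cV[R]_(\sum_(i < m) n) := \mxcol_i (Num.sqrt (p i) *: k i).
Let G : 'M[R]_(\sum_(i < m) n, n) := \mxcol_i (Num.sqrt (p i) *: S i).

Definition cell_mx : 'M[R]_(\sum_(i < m) n) :=
  \mxdiag_(i < m) (lam *: (S i *m S i)) + (1 - lam) *: (G *m G^T).

Lemma tr_cell_mx : cell_mx^T = cell_mx.
Proof.
rewrite /cell_mx linearD linearZ /= trmx_mul trmxK tr_mxdiag; congr (_ + _).
by apply: eq_mxdiag => i; rewrite linearZ /= trmx_mul symS.
Qed.

Let sqrtp i : Num.sqrt (p i) * Num.sqrt (p i) = p i.
Proof. by rewrite -expr2 sqr_sqrtr // ltW. Qed.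

Let GT_stack k : G^T *m stack k = cell_avg k.
Proof.
rewrite tr_mxcol mul_mxrow_mxcol; apply: eq_bigr => i _.
by rewrite [_^T]linearZ /= symS -scalemxAl -scalemxAr scalerA sqrtp.
Qed.

Let cell_mx_stack k : cell_mx *m stack k = stack (cell_op k).
Proof.
rewrite mulmxDl mul_mxdiag_mxcol -scalemxAl -mulmxA GT_stack mxcol_mul.
have -> : (1 - lam) *: \mxcol_i (Num.sqrt (p i) *: S i *m cell_avg k) =
    \mxcol_i ((1 - lam) *: (Num.sqrt (p i) *: S i *m cell_avg k)).
  by apply/matrixP => i j; rewrite !mxE.
rewrite -mxcolD; apply: eq_mxcol => i.
rewrite /cell_op scalerDr !scalerA -!scalemxAl -!scalemxAr !scalerA mulmxA.
by rewrite ![Num.sqrt _ * _]mulrC.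
Qed.

Let dotv_stack k l : dotv (stack k) (stack l) = cell_dot k l.
Proof.
rewrite /dotv tr_mxcol mul_mxrow_mxcol summxE; apply: eq_bigr => i _.
by rewrite [_^T]linearZ /= -scalemxAl -scalemxAr scalerA sqrtp mxE.
Qed.

Let unstack (x : 'cV[R]_(\sum_(i < m) n)) :
  {k | x = stack k}.
Proof.
exists (fun i => (Num.sqrt (p i))^-1 *: submxcol x i).
rewrite -[LHS]submxcolK; apply: eq_mxcol => i.
by rewrite scalerA mulfV ?scale1r // gt_eqF // sqrtr_gt0.
Qed.

(** Moving one [S i] to the left factor splits the form into two nonnegative parts. The first alone
    carries [lam]; the second is the gain from averaging that makes the bound in [cell_top_gt]
    strict. *)
Lemma cell_dot_op k : cell_dot k (cell_op k) =
  lam * \sum_i p i * dotv (S i *m k i) (S i *m k i) +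
  (1 - lam) * dotv (cell_avg k) (cell_avg k).
Proof.
rewrite /cell_dot {2}/cell_avg dotv_sumr !mulr_sumr -big_split /=.
apply: eq_bigr => i _; rewrite /cell_op dotvDr !dotvZr.
rewrite (dotv_sym (k i) (S i *m k i)) // (dotv_sym (k i) (cell_avg k)) //.
by rewrite (dotvC (cell_avg k)); ring.
Qed.

Lemma cell_dot_gt0 k j : k j != 0 -> 0 < cell_dot k k.
Proof.
move=> kj; rewrite /cell_dot (bigD1 j) //= ltr_pwDl ?mulr_gt0 ?dotv_gt0 //.
by apply: sumr_ge0 => i _; rewrite mulr_ge0 ?dotv_ge0 // ltW.
Qed.

Lemma cell_op_psd k : 0 <= cell_dot k (cell_op k).
Proof.
rewrite cell_dot_op addr_ge0 ?mulr_ge0 ?dotv_ge0 ?subr_ge0 ?(ltW lam_lt1) //.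
by apply: sumr_ge0 => i _; rewrite mulr_ge0 ?dotv_ge0 // ltW.
Qed.

Lemma cell_op_top : (0 < m)%N -> (0 < n)%N -> exists rho k, [/\ exists j, k j != 0,
  forall i, cell_op k i = rho *: k i &
  forall l, cell_dot l (cell_op l) <= rho * cell_dot l l].
Proof.
move=> m0 n0; have : (0 < \sum_(i < m) n)%N by rewrite sum_nat_const card_ord muln_gt0 m0.
(* The stacked dimension is a sum, not syntactically a successor; positivity of [m] and [n] makes it
   nonzero. *)
have H N (A : 'M[R]_N) : A^T = A -> (0 < N)%N -> exists rho (x : 'cV[R]_N),
    [/\ x != 0, A *m x = rho *: x & forall y, dotv y (A *m y) <= rho * dotv y y].
  by case: N A => // N A symA _; exact: symmetric_top_eigenvector.
move=> /(H _ _ tr_cell_mx)[rho [x [x0 Mx M_le]]]; have [k xE] := unstack x.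
exists rho, k; split.
- have [/existsP[j kj]|/existsPn k0] := boolP [exists j, k j != 0]; first by exists j.
  case/eqP: x0; rewrite xE -(mxcol0 (V := R) (p_ := fun _ : 'I_m => n)).
  apply: eq_mxcol => i.
  by have /negPn/eqP -> := k0 i; rewrite scaler0.
- move=> i; have : stack (cell_op k) = stack (fun i => rho *: k i).
    rewrite -cell_mx_stack -xE Mx xE; apply/matrixP => a b; rewrite !mxE.
    by rewrite mulrCA.
  rewrite /stack => /eq_mxcolP/(_ i)/scalerI; apply.
  by rewrite gt_eqF // sqrtr_gt0.
- by move=> l; rewrite -!dotv_stack -cell_mx_stack; exact: M_le.
Qed.

Section Top.
Variable rho : R.
Hypothesis rho_max : forall l, cell_dot l (cell_op l) <= rho * cell_dot l l.

(** The test function equals [y] on cell [j] and vanishes elsewhere. After division by p_j, the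
    averaging part contributes (1 - lam) p_j |S_j y|^2 > 0, which gives strictness. *)
Lemma cell_top_gt j (y : 'cV[R]_n) : S j *m y != 0 ->
  lam * dotv (S j *m y) (S j *m y) < rho * dotv y y.
Proof.
move=> Sy0; pose k := fun i => if i == j then y else 0.
have := rho_max k; rewrite cell_dot_op /cell_dot /cell_avg.
have -> : \sum_i p i *: (S i *m k i) = p j *: (S j *m y).
  rewrite (bigD1 j) //= /k eqxx big1 ?addr0 // => i /negbTE ->.
  by rewrite mulmx0 scaler0.
have -> : \sum_i p i * dotv (S i *m k i) (S i *m k i) = p j * dotv (S j *m y) (S j *m y).
  rewrite (bigD1 j) //= /k eqxx big1 ?addr0 // => i /negbTE ->.
  by rewrite mulmx0 dotv0r mulr0.
have -> : \sum_i p i * dotv (k i) (k i) = p j * dotv y y.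
  rewrite (bigD1 j) //= /k eqxx big1 ?addr0 // => i /negbTE ->.
  by rewrite dotv0r mulr0.
rewrite dotvZl dotvZr => H.
have d0 := dotv_gt0 Sy0; have pj := p_gt0 j.
have : 0 < p j * ((1 - lam) * (p j * dotv (S j *m y) (S j *m y))).
  by rewrite !mulr_gt0 // subr_gt0.
move=> H'; rewrite -(ltr_pM2l pj); lra.
Qed.

Hypothesis rho_gt0 : 0 < rho.

Lemma cell_block_le j (y : 'cV[R]_n) :
  dotv y ((lam *: (S j *m S j)) *m y) <= rho * dotv y y.
Proof.
rewrite -scalemxAl dotvZr -mulmxA (dotv_sym _ _ (symS j)).
have [->|/cell_top_gt/ltW//] := eqVneq (S j *m y) 0.
by rewrite dotv0r mulr0 mulr_ge0 ?dotv_ge0 // ltW.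
Qed.

(** This is what makes y |-> rho^2 |y|^2 - |lam S_j^2 y + e|^2 convex in [cell_tangent_bound]. *)
Lemma cell_block_norm_le j (y : 'cV[R]_n) :
  dotv ((lam *: (S j *m S j)) *m y) ((lam *: (S j *m S j)) *m y)
  <= rho ^+ 2 * dotv y y.
Proof.
apply: psd_norm_le => //; last exact: cell_block_le.
  by rewrite linearZ /= trmx_mul symS.
by move=> z; rewrite -scalemxAl dotvZr -mulmxA (dotv_sym _ _ (symS j)) mulr_ge0 ?dotv_ge0.
Qed.

Lemma cell_op_norm_le k : cell_dot (cell_op k) (cell_op k) <= rho ^+ 2 * cell_dot k k.
Proof.
rewrite -!dotv_stack -!cell_mx_stack; apply: psd_norm_le => // [|y|y].
- exact: tr_cell_mx.
- by have [l ->] := unstack y; rewrite cell_mx_stack dotv_stack; exact: cell_op_psd.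
- by have [l ->] := unstack y; rewrite cell_mx_stack !dotv_stack; exact: rho_max.
Qed.

(** Covers the values [r] at which the resolvent is singular on some cell, where [calF] gives no
    information. *)
Lemma cell_block_eigenvalue_le j r (v : 'cV[R[i]]_n) : v != 0 ->
  complexify (lam *: (S j *m S j)) *m v = r *: v -> r <= rho%:C.
Proof.
apply: symmetric_eigenvalue_le; last exact: cell_block_le.
by rewrite linearZ /= trmx_mul symS.
Qed.

(** [cell_op] acts on real vectors, so the equation for a complex [k] is expressed through its real
    and imaginary parts. They reassemble into a complex eigenvector of [cell_mx]. *)
Lemma cell_eigenvalue_le (k : 'I_m -> 'cV[R[i]]_n) r : (exists j, k j != 0) ->
  (forall i, cell_op (fun j => Remx (k j)) i = Remx (r *: k i)) ->
  (forall i, cell_op (fun j => Immx (k j)) i = Immx (r *: k i)) ->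
  r <= rho%:C.
Proof.
move=> [j kj] kRe kIm.
pose v : 'cV[R[i]]_(\sum_(i < m) n) := \mxcol_i ((Num.sqrt (p i))%:C *: k i).
have RevE (c : R[i]) : Remx (c *: v) = stack (fun i => Remx (c *: k i)).
  apply/matrixP => a b; rewrite !mxE.
  by rewrite [in LHS]mulrCA ReZl.
have ImvE (c : R[i]) : Immx (c *: v) = stack (fun i => Immx (c *: k i)).
  apply/matrixP => a b; rewrite !mxE.
  by rewrite [in LHS]mulrCA ImZl.
apply: (symmetric_eigenvalue_le (A := cell_mx) (v := v)).
- exact: tr_cell_mx.
- by move=> y; have [l ->] := unstack y; rewrite cell_mx_stack !dotv_stack.
- apply: contra kj => /eqP; rewrite -(mxcol0 (V := R[i]) (p_ := fun _ : 'I_m => n)).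
  rewrite /v => /eq_mxcolP/(_ j)/eqP; rewrite scaler_eq0 => /orP[|//].
  by rewrite (inj_eq (@complexI R) _ 0) gt_eqF // sqrtr_gt0.
apply: ReImmx_eq; rewrite ?Remx_mul ?Immx_mul -{1}(scale1r v) ?RevE ?ImvE cell_mx_stack;
  apply: eq_mxcol => i; congr (_ *: _); rewrite -?kRe -?kIm /cell_op /cell_avg;
  by under eq_bigr do rewrite scale1r; rewrite scale1r.
Qed.

End Top.
End FiniteModel.

Lemma cell_dotZ (R : realType) m n (p : 'I_m -> R) (c : R) (k l : 'I_m -> 'cV[R]_n) :
  cell_dot p (fun i => c *: k i) (fun i => c *: l i) = c ^+ 2 * cell_dot p k l.
Proof.
rewrite /cell_dot mulr_sumr; apply: eq_bigr => i _.
by rewrite dotvZl dotvZr; ring.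
Qed.

Lemma cell_opZ (R : realType) m n (p : 'I_m -> R) (S : 'I_m -> 'M[R]_n) lam (c : R) k :
  cell_op p S lam (fun i => c *: k i) = fun i => c *: cell_op p S lam k i.
Proof.
have avgZ : cell_avg p S (fun i => c *: k i) = c *: cell_avg p S k.
  rewrite /cell_avg scaler_sumr; apply: eq_bigr => j _.
  by rewrite -scalemxAr !scalerA mulrC.
apply/funext => i; rewrite /cell_op avgZ scalerDr -!scalemxAr !scalerA.
by rewrite !(mulrC c).
Qed.

(** Iterating the norm bound gives |x| <= rho^N |g| for x = A^N g. Then 2 rho^N <g, x> <= rho^(2N)
    |g|^2 + |x|^2, by expanding |rho^N g - x|^2, replaces the Cauchy-Schwarz inequality. *)
Lemma cell_iter_le (R : realType) m n (p : 'I_m -> R) (S : 'I_m -> 'M[R]_n)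
    (lam rho : R) g N :
  (forall j, 0 < p j) -> 0 < rho ->
  (forall k, cell_dot p (cell_op p S lam k) (cell_op p S lam k) <=
             rho ^+ 2 * cell_dot p k k) ->
  cell_dot p g (iter N (cell_op p S lam) g) <= cell_dot p g g * rho ^+ N.
Proof.
move=> p_gt0 rho0 op_le; set x := iter _ _ _.
have x_le : cell_dot p x x <= (rho ^+ N) ^+ 2 * cell_dot p g g.
  rewrite /x; elim: N {x} => [|N IH] /=; first by rewrite expr0 expr1n mul1r.
  apply: le_trans (op_le _) _; rewrite [rho ^+ N.+1]exprS exprMn -[leRHS]mulrA.
  by rewrite ler_pM2l // exprn_gt0.
have rN0 : 0 < rho ^+ N by rewrite exprn_gt0.
rewrite -(ler_pM2l rN0).
apply: (@le_trans _ _ (2^-1 * ((rho ^+ N) ^+ 2 * cell_dot p g g + cell_dot p x x))).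
  rewrite /cell_dot !mulr_sumr -big_split /= mulr_sumr; apply: ler_sum => i _.
  have := dotv_ge0 (rho ^+ N *: g i - x i).
  rewrite !(dotvDl, dotvDr, dotvNl, dotvNr, dotvZl, dotvZr) (dotvC (x i)) => H.
  have := mulr_ge0 (ltW (p_gt0 i)) H; lra.
lra.
Qed.

(** * Domination and growth of the iterates *)

Section Domination.
Variable R : realType.

Definition unvec (T : Type) d (x : 'cV[T]_(d * d)) : 'M[T]_d :=
  \matrix_(i, j) x (mxtens_index (j, i)) 0.

Lemma unvecK (T : Type) d (x : 'cV[T]_(d * d)) : vec (unvec x) = x.
Proof. by apply/colP => k; rewrite !mxE -surjective_pairing mxtens_unindexK. Qed.

Lemma vecK (T : Type) d (X : 'M[T]_d) : unvec (vec X) = X.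
Proof. by apply/matrixP => i j; rewrite !mxE mxtens_indexK. Qed.

Lemma sum_mxtens (V : nmodType) d e (f : 'I_(d * e) -> V) :
  \sum_k f k = \sum_a \sum_b f (mxtens_index (a, b)).
Proof.
rewrite pair_big (reindex (@mxtens_index d e)) /=.
  by apply: eq_bigr => -[a b].
by exists (@mxtens_unindex d e) => k _; rewrite ?mxtens_indexK ?mxtens_unindexK.
Qed.

Lemma tens_vec (T : comPzRingType) d (A B X : 'M[T]_d) :
  (A *t B) *m vec X = vec (B *m X *m A^T).
Proof.
apply/colP => k; rewrite !mxE sum_mxtens; apply: eq_bigr => b _.
rewrite !mxE mulr_suml; apply: eq_bigr => a _.
by rewrite !mxE !mxtens_indexK /=; ring.
Qed.

Lemma dotv_vec d (X Y : 'M[R]_d) :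
  dotv (vec X) (vec Y) = \sum_a \sum_b X a b * Y a b.
Proof.
rewrite dotvE sum_mxtens exchange_big /=; apply: eq_bigr => a _.
by apply: eq_bigr => b _; rewrite !mxE !mxtens_indexK.
Qed.

(* For symmetric [X] and [Y] this says [- Y <= X <= Y] in the Loewner order;
   it also makes sense for an arbitrary [X]. *)
Definition dominated d (X Y : 'M[R]_d) : Prop := forall u v : 'cV[R]_d,
  2 * dotv u (X *m v) <= dotv u (Y *m u) + dotv v (Y *m v).

Lemma dominated_congr d (K X Y : 'M[R]_d) : dominated X Y ->
  dominated (K *m X *m K^T) (K *m Y *m K^T).
Proof.
move=> XY u v; have := XY (K^T *m u) (K^T *m v).
by rewrite -!mulmxA !(dotv_mulmx K).
Qed.

Lemma dominatedD d (X Y X' Y' : 'M[R]_d) : dominated X Y -> dominated X' Y' ->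
  dominated (X + X') (Y + Y').
Proof.
move=> XY XY' u v; have := XY u v; have := XY' u v.
by rewrite !mulmxDl !dotvDr; lra.
Qed.

Lemma dominatedZ d (c : R) (X Y : 'M[R]_d) : 0 <= c -> dominated X Y ->
  dominated (c *: X) (c *: Y).
Proof.
move=> c0 XY u v; have := XY u v.
by rewrite -!scalemxAl !dotvZr mulrCA -mulrDr => H; rewrite ler_wpM2l.
Qed.

Lemma dominated_sum d (I : finType) (X Y : I -> 'M[R]_d) :
  (forall i, dominated (X i) (Y i)) -> dominated (\sum_i X i) (\sum_i Y i).
Proof.
move=> XY; elim/big_ind2: _ => [|X1 Y1 X2 Y2|i _]; last exact: XY.
  by move=> u v; rewrite !mul0mx !dotv0r mulr0 addr0.
exact: dominatedD.
Qed.

(** Each entry satisfies 2 X_ab u_a v_b <= |X_ab| (u_a^2 + v_b^2) <= |X_ab| (|u|^2 + |v|^2); summing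
    over the entries gives the constant. *)
Lemma dominated_scalar d (X : 'M[R]_d) (c : R) : \sum_a \sum_b `|X a b| <= c ->
  dominated X c%:M.
Proof.
move=> Xc u v; rewrite !mul_scalar_mx !dotvZr -mulrDr.
have sq_le (w : 'cV[R]_d) a : w a 0 ^+ 2 <= dotv w w.
  rewrite dotvE (bigD1 a) //= -expr2 lerDl sumr_ge0 // => b _.
  by rewrite -expr2 sqr_ge0.
apply: le_trans (ler_wpM2r (addr_ge0 (dotv_ge0 u) (dotv_ge0 v)) Xc).
rewrite dotvE mulr_sumr mulr_suml; apply: ler_sum => a _.
rewrite mxE !mulr_sumr mulr_suml; apply: ler_sum => b _.
have := sq_le u a; have := sq_le v b; have := ler_norm (X a b).
have := lerNnormlW (lexx `|X a b|).
move: (normr_ge0 (X a b)); move: (X a b) (u a 0) (v b 0) => x y z t0 xt tx zv yu.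
have [t tE] : {t : R | t = `|x|} by exists `|x|.
rewrite -tE in t0 xt tx *.
(* The sum of these two nonnegative quantities is 2 t (y^2 + z^2) - 4 x y z. *)
have : 0 <= (t - x) * (y + z) ^+ 2 by rewrite mulr_ge0 ?sqr_ge0 ?subr_ge0.
have : 0 <= (t + x) * (y - z) ^+ 2 by rewrite mulr_ge0 ?sqr_ge0 //; lra.
have : t * (y ^+ 2 + z ^+ 2) <= t * (dotv u u + dotv v v) by rewrite ler_wpM2l // lerD.
lra.
Qed.

(** Testing domination on e_a and on both signs of e_b gives |X_ab| <= (Y_aa + Y_bb) / 2. Summed
    over all pairs, the right-hand sides give d times the trace. *)
Lemma dominated_pairing d (X Y Z : 'M[R]_d) (c : R) : dominated X Y ->
  (forall a b, `|Z a b| <= c) ->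
  \sum_a \sum_b Z a b * X a b <= c * d%:R * \tr Y.
Proof.
move=> XY Zc.
have dE (W : 'M[R]_d) a b : dotv (delta_mx a 0) (W *m delta_mx b 0) = W a b.
  by rewrite /dotv trmx_delta mulmxA -rowE -colE !mxE.
have Xab a b : Z a b * X a b <= c * ((Y a a + Y b b) / 2).
  have := XY (delta_mx a 0) (delta_mx b 0).
  have := XY (delta_mx a 0) (- delta_mx b 0).
  rewrite !mulmxN dotvNr !dotvNl !dotvNr !dE opprK; have := Zc a b.
  by rewrite ler_norml => /andP[? ?] ? ?; nra.
apply: le_trans (ler_sum _ (fun a _ => ler_sum _ (fun b _ => Xab a b))) _.
rewrite le_eqVlt; apply/orP; left; apply/eqP.
under eq_bigr do rewrite -mulr_sumr -mulr_suml big_split /= sumr_const card_ord.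
rewrite -mulr_sumr -mulr_suml big_split /= sumr_const card_ord /mxtrace.
by rewrite sumrMnl -mulr_natr; field.
Qed.

End Domination.

(** * Lower bound on the growth of the iterates *)

Section Growth.
Variables (R : realType) (m d : nat) (p : 'I_m -> R) (K : 'I_m -> 'M[R]_d) (lam : R).
Hypothesis p_gt0 : forall j, 0 < p j.
Hypothesis symK : forall j, (K j)^T = K j.
Hypothesis unitK : forall j, K j \in unitmx.
Hypothesis lam_ge0 : 0 <= lam.
Hypothesis lam_lt1 : lam < 1.

Let S i := K i *t K i.
Let op := cell_op p S lam.
Let g i : 'cV[R]_(d * d) := S i *m vec 1%:M.

Let symS j : (S j)^T = S j.
Proof. by rewrite trmx_tens symK. Qed.

Let unvecS i x : unvec (S i *m x) = K i *m unvec x *m (K i)^T.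
Proof. by rewrite -{1}(unvecK x) tens_vec vecK. Qed.

Let unvecD (x y : 'cV[R]_(d * d)) : unvec (x + y) = unvec x + unvec y.
Proof. by apply/matrixP => i j; rewrite !mxE. Qed.

Let unvecZ (c : R) (x : 'cV[R]_(d * d)) : unvec (c *: x) = c *: unvec x.
Proof. by apply/matrixP => i j; rewrite !mxE. Qed.

Let unvec_sum (f : 'I_m -> 'cV[R]_(d * d)) : unvec (\sum_i f i) = \sum_i unvec (f i).
Proof. by apply/matrixP => i j; rewrite !(mxE, summxE); apply: eq_bigr => k _; rewrite mxE. Qed.

(** On unvectorized values [op] combines congruences by the [K i] with nonnegative coefficients, and
    each of these operations preserves [dominated]. *)
Lemma cell_op_dominated (x y : 'I_m -> 'cV[R]_(d * d)) :
  (forall i, dominated (unvec (x i)) (unvec (y i))) ->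
  forall i, dominated (unvec (op x i)) (unvec (op y i)).
Proof.
move=> xy i; rewrite /op /cell_op !unvecD !unvecZ; apply: dominatedD.
  by apply: dominatedZ => //; rewrite !unvecS; do 2! apply: dominated_congr.
apply: dominatedZ; first by rewrite subr_ge0 ltW.
rewrite !unvecS; apply: dominated_congr; rewrite /cell_avg !unvec_sum.
apply: dominated_sum => j; rewrite !unvecZ; apply: dominatedZ; first exact: ltW.
by rewrite !unvecS; exact: dominated_congr.
Qed.

(* The eigenvector need not be positive semidefinite: being dominated by a
   multiple of [g] is enough, and that holds since [g] is positive definite. *)
Lemma cell_iter_growth (rho : R) (h : 'I_m -> 'cV[R]_(d * d)) j : 0 < rho ->
  h j != 0 -> (forall i, op h i = rho *: h i) ->
  exists2 c : R, 0 < c & forall N, c * rho ^+ N <= cell_dot p g (iter N op g).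
Proof.
move=> rho0 hj oph.
(* Undoing the congruence by [K i] puts [h] in the form S_i vec(Z_i), to be compared with g_i = S_i
   vec(1). *)
pose Z i := invmx (K i) *m unvec (h i) *m (invmx (K i))^T.
have hE i : h i = S i *m vec (Z i).
  rewrite /S tens_vec /Z symK trmx_inv symK !mulmxA mulmxV // mul1mx.
  by rewrite -mulmxA mulVmx // mulmx1 unvecK.
(* One constant serves twice: [c%:M] dominates every [Z i], and [c] bounds every entry of [Z i]. *)
pose c : R := \sum_i \sum_a \sum_b `|Z i a b|.
have Zc_sum i : \sum_a \sum_b `|Z i a b| <= c.
  rewrite /c (bigD1 i) //= lerDl; apply: sumr_ge0 => i' _.
  by apply: sumr_ge0 => a _; apply: sumr_ge0.
have Zc i a b : `|Z i a b| <= c.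
  apply: le_trans (Zc_sum i); rewrite (bigD1 a) //= (bigD1 b) //= -addrA lerDl.
  rewrite addr_ge0 ?sumr_ge0 // => a' _; exact: sumr_ge0.
have c0 : 0 <= c by apply: le_trans (Zc_sum j); do 2! apply: sumr_ge0 => ? _.
clearbody c.
have dom N i : dominated (unvec (rho ^+ N *: h i)) (unvec (c *: iter N op g i)).
  have gE : (fun i => c *: iter N op g i) = iter N op (fun i => c *: g i).
    by elim: N => //= N <-; rewrite /op cell_opZ.
  have hNE : (fun i => rho ^+ N *: h i) = iter N op h.
    elim: N {gE} => [|N IH] /=; first by apply/funext => i'; rewrite expr0 scale1r.
    by rewrite -IH /op cell_opZ; apply/funext => i'; rewrite -/op oph scalerA exprSr.
  rewrite -[c *: _]/((fun i => c *: iter N op g i) i) gE.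
  rewrite -[_ *: h i]/((fun i => rho ^+ N *: h i) i) hNE.
  elim: N i {gE hNE} => [|N IH] i /=; last exact: cell_op_dominated.
  rewrite unvecZ hE /g !unvecS !vecK scalemxAl scalemxAr.
  apply: dominated_congr.
  have -> : c *: 1%:M = c%:M :> 'M[R]_d by rewrite scale_scalar_mx mulr1.
  exact: dominated_scalar.
(* One copy of [h] is written as S_i vec(Z_i) and its [S i] moved across, so that
   [dominated_pairing] applies to the other copy, scaled by rho^N. The resulting trace is a pairing
   with vec(1), and moving [S i] back turns it into a pairing with [g]. *)
have key N : rho ^+ N * cell_dot p h h <= (c * d%:R * c) * cell_dot p g (iter N op g).
  rewrite /cell_dot !mulr_sumr; apply: ler_sum => i _.
  rewrite mulrCA [leRHS]mulrCA ler_pM2l // -dotvZr {1}hE.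
  rewrite -(dotv_sym _ _ (symS i)) -{1}(unvecK (_ *: _)) tens_vec dotv_vec.
  have := dominated_pairing (dominated_congr (K i) (dom N i)) (Zc i).
  move=> /le_trans; apply; rewrite -[leRHS]mulrA ler_wpM2l //; first by rewrite mulr_ge0.
  rewrite -unvecS /g -(dotv_sym _ _ (symS i)) -dotvZr -scalemxAr.
  set x := S i *m _; rewrite -{2}(unvecK x).
  rewrite unvecZ mxtraceZ dotvZr ler_wpM2l // dotv_vec /mxtrace; apply: ler_sum => a _.
  rewrite (bigD1 a) //= big1 ?addr0 ?mxE ?eqxx ?mul1r //.
  by move=> b /negbTE ba; rewrite !mxE eq_sym ba mul0r.
(* In [key] the factor [c * d%:R * c] is only known to be nonnegative. Adding 1 makes the
   denominator positive, and keeps the bound because the pairing with [g] is positive. *)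
exists (cell_dot p h h / (c * d%:R * c + 1)).
  by rewrite divr_gt0 ?(cell_dot_gt0 p_gt0 hj) // ltr_wpDl // !mulr_ge0.
have cd0 : 0 <= c * d%:R * c by rewrite !mulr_ge0.
move=> N; rewrite mulrAC ler_pdivrMr ?ltr_wpDl //.
have t0 : 0 < rho ^+ N * cell_dot p h h.
  by rewrite mulr_gt0 ?exprn_gt0 ?(cell_dot_gt0 p_gt0 hj).
have tq := key N; set q := cell_dot p g _ in tq *.
have : 0 < c * d%:R * c * q := lt_le_trans t0 tq.
move: (c * d%:R * c) cd0 tq => e e0 tq eq0.
have q0 : 0 < q by rewrite ltNge; apply/negP => q0; have := mulr_ge0_le0 e0 q0; lra.
by rewrite (mulrC (cell_dot p h h)); lra.
Qed.

End Growth.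

(** * Integration over the cells *)

Section AeIntegral.
Import HBNNSimple.
Context (dX : measure_display) (X : measurableType dX) (R : realType).
Variable mu : {measure set X -> \bar R}.
Local Open Scope ereal_scope.

(* [F] is arbitrary off the cells, so [A h] is only almost everywhere equal to a
   measurable function; hence no measurability of [f] is assumed here. *)
Lemma ge0_ae_le_integral_nonmeas (f g : X -> \bar R) :
  (forall x, 0 <= f x) -> (forall x, 0 <= g x) -> measurable_fun setT g ->
  {ae mu, forall x, f x <= g x} -> \int[mu]_x f x <= \int[mu]_x g x.
Proof.
move=> f0 g0 mg fg; rewrite ge0_integralTE //.
apply/ge_ereal_sup => _ [h hf <-]; rewrite -integralT_nnsfun.
apply: ae_ge0_le_integral => //.
- by move=> x _; rewrite lee_fin.
- exact/measurable_EFinP.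
- by apply: filterS fg => x fgx _; exact: le_trans (hf x) fgx.
Qed.

Lemma ge0_le_integral_nonmeas (f g : X -> \bar R) :
  (forall x, 0 <= f x) -> (forall x, f x <= g x) -> \int[mu]_x f x <= \int[mu]_x g x.
Proof.
move=> f0 fg; have g0 x : 0 <= g x by exact: le_trans (f0 x) (fg x).
rewrite !ge0_integralTE //; apply/ge_ereal_sup => _ [h hf <-].
apply: ereal_sup_ubound; exists h => // x; exact: le_trans (hf x) (fg x).
Qed.

Lemma ge0_ae_eq_integral_nonmeas (f g : X -> \bar R) :
  (forall x, 0 <= f x) -> (forall x, 0 <= g x) -> measurable_fun setT g ->
  {ae mu, forall x, f x = g x} -> \int[mu]_x f x = \int[mu]_x g x.
Proof.
move=> f0 g0 mg fg; apply/eqP; rewrite eq_le; apply/andP; split.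
  by apply: ge0_ae_le_integral_nonmeas => //; apply: filterS fg => x ->.
(* For the other inequality, [g] is cut to 0 on a measurable null set containing the points where it
   differs from [f]; the cut function lies below [f] everywhere. *)
have [N [mN N0 fgN]] := fg.
have mNC : measurable (~` N) by exact: measurableC.
rewrite (@ge0_ae_eq_integral _ _ _ mu setT g (g \_ (~` N))) //; first last.
- exists N; split => // x /= H; apply: contrapT => Nx; apply: H => _.
  by rewrite patchE mem_set.
- by move=> x _; rewrite patchE; case: ifP.
- by apply/(measurable_restrictT _ mNC); exact: measurable_funTS.
apply: ge0_le_integral_nonmeas => x; rewrite patchE; case: ifPn => //.
rewrite inE => Nx; suff -> : f x = g x by [].
by apply: contrapT => H; apply: Nx; exact: fgN.
Qed.

Lemma ae_eq_integral_nonmeas (f g : X -> \bar R) : measurable_fun setT g ->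
  {ae mu, forall x, f x = g x} -> \int[mu]_x f x = \int[mu]_x g x.
Proof.
move=> mg fg; rewrite integralE [RHS]integralE; congr (_ - _).
  apply: ge0_ae_eq_integral_nonmeas => //; first exact: measurable_funepos.
  by apply: filterS fg => x fgx; rewrite !funeposE fgx.
apply: ge0_ae_eq_integral_nonmeas => //; first exact: measurable_funeneg.
by apply: filterS fg => x fgx; rewrite !funenegE fgx.
Qed.

Lemma ae_eq_Rintegral (f g : X -> R) : measurable_fun setT g ->
  {ae mu, forall x, f x = g x} ->
  Rintegral mu setT f = Rintegral mu setT g.
Proof.
move=> mg fg; congr fine; apply: ae_eq_integral_nonmeas.
  exact/measurable_EFinP.
by apply: filterS fg => x ->.
Qed.

End AeIntegral.

(** * Expectations of functions constant on the cells *)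

Section Cells.
Context (dX : measure_display) (X : measurableType dX) (R : realType).
Variables (mu : probability X R) (d m : nat) (F : X -> 'M[R]_d) (B : 'I_m -> 'M[R]_d).
Hypothesis F_simple : ae_simple mu F B.

Let cell j : set X := F @^-1` [set B j].
Definition cell_prob j : R := fine (mu (F @^-1` [set B j])).

Let mcell j : measurable (cell j).
Proof. by have [_ _ + _ _] := F_simple; apply. Qed.

Let mu_cell j : mu (cell j) = (cell_prob j)%:E.
Proof. by rewrite /cell_prob fineK //; apply: fin_num_measure; exact: mcell. Qed.

Lemma cell_prob_gt0 j : 0 < cell_prob j.
Proof. by have [_ _ _ /(_ j)] := F_simple; rewrite -/(cell j) mu_cell lte_fin. Qed.

Lemma ae_cell : {ae mu, forall x, exists j, F x = B j}.
Proof.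
have trivcell : trivIset setT cell.
  by apply/trivIsetP => i j _ _ ij; apply/seteqP; split => // x [Fi Fj];
    move: ij; rewrite (_ : i = j) ?eqxx //; have [+ _ _ _ _] := F_simple; apply;
    exact: etrans (esym Fi) Fj.
pose U := \bigcup_(j in [set: 'I_m]) cell j.
have mU : measurable U by apply: fin_bigcup_measurable => //; exact: finite_finset.
have U1 : mu U = 1%E.
  rewrite measure_fin_bigcup //; last exact: finite_finset.
  have -> : [set: 'I_m] = [set` index_enum 'I_m].
    by apply/seteqP; split => // i _; rewrite /= mem_index_enum.
  by rewrite -fsbig_seq ?index_enum_uniq //; have [_ _ _ _ <-] := F_simple.
exists (~` U); split; first exact: measurableC.
  by rewrite probability_setC // U1 subee.
by move=> x /= H [j _ Fx]; apply: H; exists j.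
Qed.

(** The form of the hypothesis is used throughout for functions constant on the cells: it says
    nothing about points off the cells, which form a null set by [ae_cell]. *)
Lemma Rintegral_cell (f : X -> R) (k : 'I_m -> R) :
  {ae mu, forall x j, F x = B j -> f x = k j} ->
  Rintegral mu setT f = \sum_j cell_prob j * k j.
Proof.
move=> fk; pose g x := \sum_j k j * \1_(cell j) x.
have mg : measurable_fun setT g.
  by apply: measurable_sum => j; apply: measurable_funM => //; exact: measurable_indic.
rewrite (ae_eq_Rintegral mg); last first.
  apply: filterS2 ae_cell fk => x [j Fx] /(_ _ Fx) ->.
  rewrite /g (bigD1 j) //= big1 ?addr0 => [|i ij].
    by rewrite indicE mem_set // mulr1.
  rewrite indicE memNset ?mulr0 // /cell /= Fx => BB.
  by move: ij; rewrite (_ : i = j) ?eqxx //; have [+ _ _ _ _] := F_simple; apply.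
rewrite /Rintegral; under eq_integral do rewrite /g -sumEFin.
have icell j : mu.-integrable setT (fun x => (\1_(cell j) x)%:E).
  exact: integrable_indic.
rewrite integral_sum //; last first.
  by move=> j; under eq_fun do rewrite EFinM; exact: integrableZl.
under eq_bigr => j _.
  under eq_integral do rewrite EFinM.
  rewrite integralZl // integral_indic // setIT [X in (_ * X)%E](mu_cell j) -EFinM mulrC; over.
by rewrite sumEFin.
Qed.

Lemma Cexpectation_cell (f : X -> R[i]) (k : 'I_m -> R[i]) :
  {ae mu, forall x j, F x = B j -> f x = k j} ->
  Cexpectation mu f = \sum_j (cell_prob j)%:C * k j.
Proof.
move=> fk; apply/eqP; rewrite eq_complex /= Re_sum Im_sum; apply/andP; split; apply/eqP.
  under [RHS]eq_bigr do rewrite ReZl.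
  by apply: Rintegral_cell; apply: filterS fk => x fk j /fk ->.
under [RHS]eq_bigr do rewrite ImZl.
by apply: Rintegral_cell; apply: filterS fk => x fk j /fk ->.
Qed.

End Cells.

Section RealIntegral.
Context (dX : measure_display) (X : measurableType dX) (R : realType).
Variable mu : probability X R.
Local Notation integrable f := (mu.-integrable setT (EFin \o f)).

Lemma integrableDr (f g : X -> R) : integrable f -> integrable g ->
  integrable (fun x => f x + g x).
Proof. by move=> fi gi; have := integrableD measurableT fi gi. Qed.

Lemma integrableZr (c : R) (f : X -> R) : integrable f ->
  integrable (fun x => c * f x).
Proof. by move=> fi; have := integrableZl measurableT c fi. Qed.

Lemma integrable_sumr (I : Type) (s : seq I) (f : I -> X -> R) :
  (forall i, integrable (f i)) -> integrable (fun x => \sum_(i <- s) f i x).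
Proof.
move=> fi; have -> : EFin \o (fun x => \sum_(i <- s) f i x) =
    (fun x => \sum_(i <- s) (f i x)%:E)%E.
  by apply/funext => x /=; rewrite sumEFin.
by apply: integrable_sum => // i _; exact: fi.
Qed.

Lemma Rintegral_sum (I : Type) (s : seq I) (f : I -> X -> R) :
  (forall i, integrable (f i)) ->
  Rintegral mu setT (fun x => \sum_(i <- s) f i x) = \sum_(i <- s) Rintegral mu setT (f i).
Proof.
move=> fi; elim: s => [|i s IH].
  rewrite big_nil -[RHS](mul0r (fine (mu setT))) -Rintegral_cst //.
  by apply: eq_Rintegral => x _; rewrite big_nil.
rewrite big_cons -IH -RintegralD //; last exact: integrable_sumr.
by apply: eq_Rintegral => x _; rewrite big_cons.
Qed.

Lemma measurable_of_integrable (f : X -> R) : integrable f -> measurable_fun setT f.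
Proof. by move=> /measurable_int /measurable_EFinP. Qed.

(** [g] may be negative on a null set, so it is replaced by its maximum with 0. Its integrability
    keeps both integrals finite, where [fine] is monotone. *)
Lemma ge0_ae_le_Rintegral (f g : X -> R) : (forall x, 0 <= f x) -> integrable g ->
  {ae mu, forall x, f x <= g x} -> Rintegral mu setT f <= Rintegral mu setT g.
Proof.
move=> f0 gi fg; have mg := measurable_of_integrable gi.
pose g' x := Num.max (g x) 0.
have mg' : measurable_fun setT g' by exact: measurable_maxr.
have g'0 x : 0 <= g' x by rewrite le_max lexx orbT.
have gg' : {ae mu, forall x, setT x -> (g x)%:E = (g' x)%:E}.
  apply: filterS fg => x fgx _; congr EFin; rewrite /g' max_l //.
  exact: le_trans (f0 x) fgx.
have intE : (\int[mu]_x (g x)%:E = \int[mu]_x (g' x)%:E)%E.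
  by apply: ae_eq_integral => //; exact/measurable_EFinP.
have le_fg : (\int[mu]_x (f x)%:E <= \int[mu]_x (g x)%:E)%E.
  rewrite intE; apply: ge0_ae_le_integral_nonmeas.
  - by move=> x; rewrite lee_fin.
  - by move=> x; rewrite lee_fin.
  - exact/measurable_EFinP.
  - apply: filterS fg => x fgx; rewrite lee_fin; apply: le_trans fgx _.
    by rewrite le_max lexx.
have gfin : (\int[mu]_x (g x)%:E)%E \is a fin_num.
  exact: (@integrable_fin_num _ _ _ _ setT _ (EFin \o g)).
rewrite /Rintegral fine_le //.
have f_ge0 : (0 <= \int[mu]_x (f x)%:E)%E by apply: integral_ge0 => x _; rewrite lee_fin.
by rewrite ge0_fin_numE // (le_lt_trans le_fg) // ltey_eq gfin.
Qed.

End RealIntegral.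

(** * From cell means to arbitrary functions: the tangent bound *)

Section NormBound.
Context (dX : measure_display) (X : measurableType dX) (R : realType).
Variables (mu : probability X R) (d m n : nat) (F : X -> 'M[R]_d) (B : 'I_m -> 'M[R]_d).
Hypothesis F_simple : ae_simple mu F B.
Variables (S : 'I_m -> 'M[R]_n) (lam rho : R).
Hypothesis symS : forall j, (S j)^T = S j.
Hypothesis lam_ge0 : 0 <= lam.
Hypothesis lam_lt1 : lam < 1.
Hypothesis rho_gt0 : 0 < rho.
Let p := cell_prob mu F B.
Hypothesis rho_max : forall l, cell_dot p l (cell_op p S lam l) <= rho * cell_dot p l l.
Local Notation integrable f := (mu.-integrable setT (EFin \o f)).
Local Notation ind j := (\1_(F @^-1` [set B j]) : X -> R).

Let p_gt0 j : 0 < p j.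
Proof. exact: cell_prob_gt0. Qed.

Let B_inj : injective B. Proof. by have [] := F_simple. Qed.

Let mcell j : measurable (F @^-1` [set B j]).
Proof. by have [_ _ + _ _] := F_simple; apply. Qed.

Lemma cell_indicE x i j : F x = B i -> ind j x = (j == i)%:R.
Proof.
move=> Fx; rewrite indicE; congr (_%:R); congr nat_of_bool.
apply/idP/eqP => [|->]; last by rewrite inE.
by rewrite inE /= Fx => /B_inj.
Qed.

Lemma integrable_cell_indic j (f : X -> R) : integrable f ->
  integrable (fun x => ind j x * f x).
Proof.
move=> fi; apply: (le_integrable _ _ _ fi) => //.
  apply/measurable_EFinP; apply: measurable_funM; first exact: measurable_indic.
  exact: measurable_of_integrable fi.
move=> x _ /=; rewrite lee_fin normrM ler_piMl // indicE.
by case: (_ \in _); rewrite ?normr1 ?normr0.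
Qed.

Definition cell_integral (u : X -> 'cV[R]_n) j : 'cV[R]_n :=
  \col_a Rintegral mu setT (fun x => ind j x * u x a 0).

(* The pointwise bound is the tangent inequality at the cell mean for the convex
   quadratic function [y |-> rho^2 |y|^2 - |lam S_j^2 y + e|^2]. *)
Lemma cell_tangent_bound (u : X -> 'cV[R]_n) (w : 'cV[R]_n) :
  (forall a, integrable (fun x => u x a 0)) ->
  integrable (fun x => dotv (u x) (u x)) ->
  w = \sum_j S j *m cell_integral u j ->
  exists g : X -> R, [/\ integrable g,
    Rintegral mu setT g <= rho ^+ 2 * Rintegral mu setT (fun x => dotv (u x) (u x)) &
    forall x i z, F x = B i ->
      z = lam *: (S i *m (S i *m u x)) + (1 - lam) *: (S i *m w) -> dotv z z <= g x].
Proof.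
move=> iu iuu wE.
(* The mean of [u] over cell [j]. *)
pose kbar j := (p j)^-1 *: cell_integral u j.
have ckbar j : cell_integral u j = p j *: kbar j.
  by rewrite scalerA mulfV ?scale1r // gt_eqF.
have w_avg : w = cell_avg p S kbar.
  by rewrite wE; apply: eq_bigr => j _; rewrite ckbar -scalemxAr.
clearbody kbar.
pose Ak := cell_op p S lam kbar.
(* [G j] and [Phi j] are the gradient and the value at [kbar j] of the convex function, with e = (1
   - lam) S_j w; [beta j] is the tangent affine function in u(x), restricted to cell [j]. *)
pose G j := 2 *: (rho ^+ 2 *: kbar j - lam *: (S j *m (S j *m Ak j))).
pose Phi j := rho ^+ 2 * dotv (kbar j) (kbar j) - dotv (Ak j) (Ak j).
pose beta j x := (Phi j - dotv (G j) (kbar j)) * ind j x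
               + \sum_a G j a 0 * (ind j x * u x a 0).
have iind j : integrable (ind j) by exact: integrable_indic.
have iGu j : integrable (fun x => \sum_a G j a 0 * (ind j x * u x a 0)).
  apply: integrable_sumr => a; apply: integrableZr; exact: integrable_cell_indic.
have ibeta j : integrable (beta j) by apply: integrableDr; [exact: integrableZr|].
pose g x := rho ^+ 2 * dotv (u x) (u x) + (- 1) * \sum_j beta j x.
have isb : integrable (fun x => \sum_j beta j x) by exact: integrable_sumr.
have irho : integrable (fun x => rho ^+ 2 * dotv (u x) (u x)) by exact: integrableZr.
(* The linear part of the tangent integrates to zero because [kbar j] is the cell mean. *)
have beta_int j : Rintegral mu setT (beta j) = p j * Phi j.
  rewrite RintegralD //; last exact: integrableZr.
  rewrite RintegralZl // Rintegral_sum; last first.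
    by move=> a; apply: integrableZr; exact: integrable_cell_indic.
  have -> : Rintegral mu setT (ind j) = p j by rewrite /Rintegral integral_indic // setIT.
  under eq_bigr => a _.
    rewrite RintegralZl //; last exact: integrable_cell_indic.
    rewrite (_ : Rintegral _ _ _ = cell_integral u j a 0); last by rewrite mxE.
    over.
  rewrite -dotvE ckbar dotvZr; ring.
exists g; split.
- by apply: integrableDr => //; exact: integrableZr.
- rewrite RintegralD //; last exact: integrableZr.
  rewrite RintegralZl // RintegralZl // Rintegral_sum // mulN1r gerDl oppr_le0.
  under eq_bigr do rewrite beta_int /Phi mulrBr.
  rewrite big_split /= sumrN subr_ge0.
  (* The integral of the tangents, the sum of p_j Phi_j, is nonnegative: this is the norm bound for
     the cell means. *)
  have := cell_op_norm_le p_gt0 symS lam_ge0 lam_lt1 rho_max rho_gt0 kbar.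
  rewrite /cell_dot mulr_sumr => /le_trans; apply.
  by apply: ler_sum => j _; rewrite mulrCA.
move=> x i z Fx zdef.
have betaE : \sum_j beta j x = Phi i - dotv (G i) (kbar i) + dotv (G i) (u x).
  rewrite (bigD1 i) //= big1 ?addr0 => [|j /negbTE ji]; rewrite /beta (cell_indicE _ Fx).
    rewrite eqxx mulr1; congr (_ + _); rewrite dotvE.
    by apply: eq_bigr => a _; rewrite mul1r.
  by rewrite ji mulr0 add0r big1 // => a _; rewrite mul0r mulr0.
rewrite /g betaE; pose T := lam *: (S i *m S i); pose y := u x - kbar i.
have TE v : lam *: (S i *m (S i *m v)) = T *m v by rewrite mulmxA scalemxAl.
have symT : T^T = T by rewrite linearZ /= trmx_mul symS.
have zE : z = Ak i + T *m y.
  rewrite zdef /Ak /cell_op -w_avg !TE /y mulmxBr.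
  by rewrite [RHS]addrAC [T *m kbar i + _]addrC subrK.
have uE : u x = kbar i + y by rewrite /y addrC subrK.
(* The first-order terms cancel by symmetry of [T]; what remains is rho^2 |y|^2 - |T y|^2 >= 0. *)
have := cell_block_norm_le p_gt0 symS lam_ge0 lam_lt1 rho_max rho_gt0 i y.
rewrite -/T zE uE /Phi /G TE; clearbody y T Ak.
rewrite !(dotvDl, dotvDr, dotvNl, dotvNr, dotvZl, dotvZr).
rewrite -(dotv_sym (Ak i) y symT) (dotvC y (kbar i)) (dotvC (T *m y) (Ak i)).
lra.
Qed.

End NormBound.

(** * The perturbed Leon-Perron operator *)

Section PerturbedOperator.
Context (dX : measure_display) (X : measurableType dX) (R : realType).
Variables (mu : probability X R) (d m : nat) (lam theta : R).
Variables (F : X -> 'M[R]_d) (B : 'I_m -> 'M[R]_d).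
Hypothesis F_simple : ae_simple mu F B.
Let p := cell_prob mu F B.
Let S j := expmx ((theta / 2) *: kron_avg (B j)).
Let A := perturbed_op mu F lam theta.
Local Notation ind j := (\1_(F @^-1` [set B j]) : X -> R).

(** A failure at some [j] would put the whole cell [j] in a null set, while every cell has positive
    measure. *)
Lemma ae_cell_const (Q : 'I_m -> Prop) :
  {ae mu, forall x j, F x = B j -> Q j} -> forall j, Q j.
Proof.
move=> [N [mN N0 sub]] j; apply: contrapT => nQ.
have [_ _ /(_ j) mj /(_ j) mu_gt0 _] := F_simple.
suff mu0 : mu (F @^-1` [set B j]) = 0%E by rewrite mu0 ltxx in mu_gt0.
apply: (subset_measure0 mj mN _ N0) => x Fx; apply: sub => H; exact: nQ (H _ Fx).
Qed.

Lemma ae_cellP (Q : X -> Prop) :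
  {ae mu, forall x, Q x} <-> {ae mu, forall x j, F x = B j -> Q x}.
Proof.
split; first by apply: filterS => x Qx j _.
by apply: filterS2 (ae_cell F_simple) => x [j Fx] /(_ _ Fx).
Qed.

Lemma symB j : (B j)^T = B j.
Proof. by have [_ + _ _ _] := F_simple; apply. Qed.

Lemma sym_expmx_kron j : (S j)^T = S j.
Proof. by apply: tr_expmx; rewrite linearZ /= tr_kron_avg // symB. Qed.

Lemma expT_halfE x j : F x = B j -> expT F (theta / 2) x = complexify (S j).
Proof. by rewrite /expT => ->. Qed.

Lemma expTE x j : F x = B j -> expT F theta x = complexify (S j *m S j).
Proof. by rewrite /expT => ->; rewrite expmx_half // tr_kron_avg // symB. Qed.

Definition weighted_mean (h : X -> 'cV[R[i]]_(d * d)) : 'cV[R[i]]_(d * d) :=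
  mxexpectation mu (fun x => expT F (theta / 2) x *m h x).

Lemma perturbed_opE h x i : F x = B i ->
  A h x = lam%:C *: (complexify (S i) *m (complexify (S i) *m h x))
        + (1 - lam)%:C *: (complexify (S i) *m weighted_mean h).
Proof.
move=> Fx; rewrite /A /perturbed_op /= /mulop /leon_perron /tensor_id.
rewrite !(expT_halfE Fx) scalemxAr [X in _ = _ + X]scalemxAr -mulmxDr; congr (_ *m _).
by apply/colP => a; rewrite !mxE /const_proj; congr (_ * _ + _).
Qed.

Lemma weighted_mean_cell h (k : 'I_m -> 'cV[R[i]]_(d * d)) :
  {ae mu, forall x j, F x = B j -> h x = k j} ->
  weighted_mean h = \sum_j (p j)%:C *: (complexify (S j) *m k j).
Proof.
move=> hk; apply/colP => a; rewrite mxE summxE.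
rewrite (Cexpectation_cell F_simple (k := fun j => (complexify (S j) *m k j) a 0)).
  by apply: eq_bigr => j _; rewrite [RHS]mxE.
by apply: filterS hk => x hk j Fx; rewrite (hk _ Fx) (expT_halfE Fx).
Qed.

Lemma cdotE n (v : 'cV[R[i]]_n) :
  complex.Re (cdot v v) = dotv (Remx v) (Remx v) + dotv (Immx v) (Immx v).
Proof.
rewrite /cdot Re_sum !dotvE -big_split; apply: eq_bigr => a _ /=; rewrite !mxE.
by case: (v a 0) => x y /=; ring.
Qed.

Lemma L2_cell h (k : 'I_m -> 'cV[R[i]]_(d * d)) :
  {ae mu, forall x j, F x = B j -> h x = k j} -> L2 mu h.
Proof.
move=> hk; pose g x := \sum_j (ind j x)%:C *: k j.
have mind j : measurable_fun setT (ind j).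
  by apply: measurable_indic; have [_ _ + _ _] := F_simple; apply.
have gE x j : F x = B j -> g x = k j.
  move=> Fx; rewrite /g (bigD1 j) //= big1 ?addr0 => [|i /negbTE ij].
    by rewrite (cell_indicE F_simple _ Fx) eqxx scale1r.
  by rewrite (cell_indicE F_simple _ Fx) ij scale0r.
exists g; split.
- move=> a; split.
    have -> : (fun x => complex.Re (g x a 0)) =
        fun x => \sum_j ind j x * complex.Re (k j a 0).
      apply/funext => x; rewrite /g summxE Re_sum; apply: eq_bigr => j _.
      by rewrite mxE ReZl.
    by apply: measurable_sum => j; exact: measurable_funM.
  have -> : (fun x => complex.Im (g x a 0)) =
      fun x => \sum_j ind j x * complex.Im (k j a 0).
    apply/funext => x; rewrite /g summxE Im_sum; apply: eq_bigr => j _.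
    by rewrite mxE ImZl.
  by apply: measurable_sum => j; exact: measurable_funM.
- apply/ae_cellP; apply: filterS hk => x hk j Fx.
  by rewrite (hk _ Fx) (gE _ _ Fx).
have c_ge0 (v : 'cV[R[i]]_(d * d)) : 0 <= complex.Re (cdot v v).
  by rewrite cdotE addr_ge0 ?dotv_ge0.
pose M := \sum_j complex.Re (cdot (k j) (k j)).
have M0 : 0 <= M by apply: sumr_ge0 => j _; exact: c_ge0.
apply: (@le_lt_trans _ _ (\int[mu]_x (cst M%:E x))%E).
  apply: ge0_ae_le_integral_nonmeas => // [x|].
    by rewrite lee_fin c_ge0.
  apply/ae_cellP; apply: nearW => x j Fx; rewrite (gE _ _ Fx) lee_fin.
  rewrite /M (bigD1 j) //= lerDl; apply: sumr_ge0 => i _; exact: c_ge0.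
by rewrite integral_cst // [X in (_ * X)%E](probability_setT mu) mule1 ltry.
Qed.

(** [N r j] and [kk r v j] are the values on cell [j] of [resolvent_mx] and of
    [calF_eigenfunction]. *)
Let N (r : R[i]) j : 'M[R[i]]_(d * d) := r%:M - lam%:C *: complexify (S j *m S j).
Let kk (r : R[i]) (v : 'cV[R[i]]_(d * d)) j : 'cV[R[i]]_(d * d) :=
  (1 - lam)%:C *: (invmx (N r j) *m (complexify (S j) *m v)).

Lemma calF_eigenfunctionE r v x j : F x = B j ->
  calF_eigenfunction F lam theta r v x = kk r v j.
Proof.
by move=> Fx; rewrite /calF_eigenfunction /resolvent_mx (expT_halfE Fx) (expTE Fx).
Qed.

(** Identifies calF(r) v = v as the consistency condition that the candidate h built from [v]
    satisfies E[S h] = v. *)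
Lemma weighted_mean_calF r v :
  weighted_mean (calF_eigenfunction F lam theta r v) = calF mu F lam theta r *m v.
Proof.
rewrite (weighted_mean_cell (k := kk r v)); last first.
  by apply: nearW => x j; exact: calF_eigenfunctionE.
have -> : calF mu F lam theta r = \sum_j (p j)%:C *: ((1 - lam)%:C *:
    (complexify (S j) *m invmx (N r j) *m complexify (S j))).
  apply/matrixP => a b; rewrite mxE summxE.
  rewrite (Cexpectation_cell F_simple (k := fun j => ((1 - lam)%:C *:
    (complexify (S j) *m invmx (N r j) *m complexify (S j))) a b)).
    by apply: eq_bigr => j _; rewrite [RHS]mxE.
  apply: nearW => x j Fx.
  by rewrite /resolvent_mx (expT_halfE Fx) (expTE Fx).
rewrite mulmx_suml; apply: eq_bigr => j _.
by rewrite /kk -!scalemxAr -!scalemxAl !mulmxA.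
Qed.

Lemma calF_definedP r : calF_defined mu F lam theta r <-> forall j, N r j \in unitmx.
Proof.
split=> [|Nu]; last first.
  by apply/ae_cellP; apply: nearW => x j Fx; rewrite /resolvent_mx (expTE Fx);
    exact: Nu.
move=> /ae_cellP defF; apply: ae_cell_const; apply: filterS defF => x defF j Fx.
by have := defF _ Fx; rewrite /resolvent_mx (expTE Fx).
Qed.

Lemma mul_resolvent r j (v : 'cV[R[i]]_(d * d)) :
  N r j *m v = r *: v - lam%:C *: (complexify (S j) *m (complexify (S j) *m v)).
Proof.
by rewrite mulmxBl mul_scalar_mx -scalemxAl /complexify map_mxM mulmxA.
Qed.

Lemma calF_eigenvector_eigenfunction r v : calF_defined mu F lam theta r ->
  v != 0 -> calF mu F lam theta r *m v = v ->
  eigenfunction mu A r (calF_eigenfunction F lam theta r v).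
Proof.
move=> /calF_definedP Nu v0 Fv; set h := calF_eigenfunction F lam theta r v.
have hk : {ae mu, forall x j, F x = B j -> h x = kk r v j}.
  by apply: nearW => x j; exact: calF_eigenfunctionE.
have hv : weighted_mean h = v by rewrite weighted_mean_calF.
split; first exact: L2_cell hk.
  move=> h0; case/eqP: v0; rewrite -hv (weighted_mean_cell (k := fun=> 0)).
    by rewrite big1 // => j _; rewrite mulmx0 scaler0.
  by apply: filterS h0 => x -> j _.
apply/ae_cellP; apply: filterS hk => x hk j Fx; rewrite (perturbed_opE _ Fx) hv.
have <- : N r j *m h x = (1 - lam)%:C *: (complexify (S j) *m v).
  by rewrite (hk _ Fx) /kk -scalemxAr mulmxA mulmxV // mul1mx.
by rewrite mul_resolvent addrC subrK.
Qed.

Lemma eigenfunction_calF r h : calF_defined mu F lam theta r ->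
  eigenfunction mu A r h ->
  exists v, [/\ v != 0, calF mu F lam theta r *m v = v &
    ae_equal mu h (calF_eigenfunction F lam theta r v)].
Proof.
move=> /calF_definedP Nu [_ h0 Ah]; pose v := weighted_mean h.
have hk : {ae mu, forall x j, F x = B j -> h x = kk r v j}.
  apply: filterS Ah => x Ahx j Fx.
  have : N r j *m h x = (1 - lam)%:C *: (complexify (S j) *m v).
    by rewrite mul_resolvent -Ahx (perturbed_opE _ Fx) addrAC subrr add0r.
  move=> /(congr1 (mulmx (invmx (N r j)))); rewrite mulmxA mulVmx // mul1mx => ->.
  by rewrite -scalemxAr.
have hcalF : ae_equal mu h (calF_eigenfunction F lam theta r v).
  apply/ae_cellP; apply: filterS hk => x hk j Fx.
  by rewrite (hk _ Fx) (calF_eigenfunctionE _ _ Fx).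
exists v; split=> //.
  apply/eqP => v0; apply: h0; apply/ae_cellP; apply: filterS hk => x hk j Fx.
  by rewrite (hk _ Fx) /kk v0 !mulmx0 scaler0.
rewrite -weighted_mean_calF (weighted_mean_cell (k := kk r v)).
  by rewrite {2}/v (weighted_mean_cell hk).
by apply: nearW => x j; exact: calF_eigenfunctionE.
Qed.

Lemma complexify_cell_op (k : 'I_m -> 'cV[R]_(d * d)) i :
  complexify (cell_op p S lam k i) =
  lam%:C *: (complexify (S i) *m (complexify (S i) *m complexify (k i)))
  + (1 - lam)%:C *: (complexify (S i) *m
      \sum_j (p j)%:C *: (complexify (S j) *m complexify (k j))).
Proof.
rewrite /complexify map_mxD !map_mxZ !map_mxM; congr (_ + _ *: (_ *m _)).
by rewrite map_mx_sum; apply: eq_bigr => j _; rewrite map_mxZ map_mxM.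
Qed.

Lemma perturbed_op_cell h (k : 'I_m -> 'cV[R]_(d * d)) :
  {ae mu, forall x j, F x = B j -> h x = complexify (k j)} ->
  {ae mu, forall x j, F x = B j -> A h x = complexify (cell_op p S lam k j)}.
Proof.
move=> hk; have wE := weighted_mean_cell hk.
apply: filterS hk => x hk j Fx.
by rewrite (perturbed_opE _ Fx) complexify_cell_op wE (hk _ Fx).
Qed.

Lemma L2inner_cell h h' (k k' : 'I_m -> 'cV[R]_(d * d)) :
  {ae mu, forall x j, F x = B j -> h x = complexify (k j)} ->
  {ae mu, forall x j, F x = B j -> h' x = complexify (k' j)} ->
  L2inner mu h h' = (cell_dot p k k')%:C.
Proof.
move=> hk hk'; rewrite /L2inner.
rewrite (Cexpectation_cell F_simple (k := fun j => (dotv (k j) (k' j))%:C)).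
  by rewrite /cell_dot rmorph_sum; apply: eq_bigr => j _; rewrite rmorphM.
apply: filterS2 hk hk' => x hk hk' j Fx; rewrite (hk _ Fx) (hk' _ Fx).
rewrite dotvE rmorph_sum; apply: eq_bigr => a _.
rewrite !mxE; apply/eqP; rewrite eq_complex /=.
by apply/andP; split; apply/eqP; ring.
Qed.

(** If the resolvent is singular on a cell, [r] is an eigenvalue of that block. Otherwise
    [eigenfunction_calF] makes the eigenfunction constant on the cells, and the finite model
    applies. *)
Lemma eigenvalue_le_top (rho : R) : 0 <= lam -> lam < 1 -> 0 < rho ->
  (forall l, cell_dot p l (cell_op p S lam l) <= rho * cell_dot p l l) ->
  forall r, op_eigenvalue mu A r -> r <= rho%:C.
Proof.
move=> lam_ge0 lam_lt1 rho_gt0 rho_max r [h heig].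
have p_gt0 j : 0 < p j by exact: cell_prob_gt0.
have [[j Nj]|Nu] := pselect (exists j, N r j \notin unitmx).
  (* [det0P] produces a left null vector, so it is applied to the transpose; [v^T] is then an
     eigenvector of lam S_j^2 for [r]. *)
  have /det0P[v v0 vN] : \det (N r j)^T == 0.
    by rewrite det_tr; move: Nj; rewrite unitmxE unitfE negbK.
  have := @cell_block_eigenvalue_le R m (d * d)%N p S lam p_gt0 sym_expmx_kron
    lam_lt1 rho rho_max rho_gt0 j r v^T; apply.
    by rewrite -trmx0 (inj_eq (@trmx_inj _ _ _)).
  have : N r j *m v^T = 0 by rewrite -[N r j]trmxK -trmx_mul vN trmx0.
  rewrite mulmxBl mul_scalar_mx => /eqP; rewrite subr_eq0 => /eqP ->.
  by rewrite /complexify map_mxZ.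
have {}Nu j : N r j \in unitmx by apply: contrapT => /negP Nj; apply: Nu; exists j.
have [v [v0 Fv hcalF]] := eigenfunction_calF ((calF_definedP r).2 Nu) heig.
have hk : {ae mu, forall x j, F x = B j -> h x = kk r v j}.
  by apply: filterS hcalF => x -> j; exact: calF_eigenfunctionE.
have wE : v = \sum_j (p j)%:C *: (complexify (S j) *m kk r v j).
  rewrite -{1}Fv -weighted_mean_calF; apply: weighted_mean_cell.
  by apply: nearW => x j; exact: calF_eigenfunctionE.
have [_ _ Ah] := heig.
have hw : weighted_mean h = v by rewrite wE; exact: weighted_mean_cell.
(* The almost everywhere eigenvalue equation, once written with constants only, holds exactly on
   each cell. *)
have eigE : forall i, lam%:C *: (complexify (S i) *m (complexify (S i) *m kk r v i))
    + (1 - lam)%:C *: (complexify (S i) *m v) = r *: kk r v i.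
  apply: ae_cell_const; apply: filterS2 hk Ah => x hk Ahx i Fx.
  by rewrite -(hk _ Fx) -Ahx (perturbed_opE _ Fx) hw.
move: (kk r v) {hk} wE eigE => kv wE eigE.
apply: (cell_eigenvalue_le p_gt0 sym_expmx_kron rho_max (k := kv)).
- apply: contrapT => k0; case/eqP: v0; rewrite wE big1 // => j _.
  have [->|kj] := eqVneq (kv j) 0; first by rewrite mulmx0 scaler0.
  by case: k0; exists j.
- have vE : Remx v = cell_avg p S (fun j => Remx (kv j)).
    by rewrite {1}wE Remx_sum; apply: eq_bigr => j _; rewrite RemxZr Remx_mul.
  by move=> i; rewrite -eigE RemxD !RemxZr !Remx_mul /cell_op -vE.
- have vE : Immx v = cell_avg p S (fun j => Immx (kv j)).
    by rewrite {1}wE Immx_sum; apply: eq_bigr => j _; rewrite ImmxZr Immx_mul.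
  by move=> i; rewrite -eigE ImmxD !ImmxZr !Immx_mul /cell_op -vE.
Qed.

(** Uses |t| <= 1 + t^2 and the integrability of constants for a probability measure. *)
Lemma integrable_coord n (u : X -> 'cV[R]_n) a :
  measurable_fun setT (fun x => u x a 0) ->
  mu.-integrable setT (EFin \o (fun x => dotv (u x) (u x))) ->
  mu.-integrable setT (EFin \o (fun x => u x a 0)).
Proof.
move=> mu_a iuu.
have i1 : mu.-integrable setT (EFin \o cst (1 : R)) by exact: finite_measure_integrable_cst.
apply: (le_integrable _ _ _ (integrableDr i1 iuu)) => //.
  exact/measurable_EFinP.
move=> x _ /=; rewrite lee_fin.
have : u x a 0 ^+ 2 <= dotv (u x) (u x).
  rewrite dotvE (bigD1 a) //= -expr2 lerDl sumr_ge0 // => b _.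
  by rewrite -expr2 sqr_ge0.
have := ler_norm (1 + dotv (u x) (u x)); rewrite -(real_normK (num_real (u x a 0))).
have := sqr_ge0 (`|u x a 0| - 1); have := normr_ge0 (u x a 0).
set t := `|u x a 0|; move=> t0 t1 le1 le2; apply: le_trans le1.
by rewrite sqrrB in t1; nra.
Qed.

(** The matrices acting on the cells are real, so [cell_tangent_bound] is applied separately to the
    real and imaginary parts of a measurable representative, and the two squared bounds are
    added. *)
Lemma L2norm_op_le (rho : R) h : 0 <= lam -> lam < 1 -> 0 < rho ->
  (forall l, cell_dot p l (cell_op p S lam l) <= rho * cell_dot p l l) ->
  L2 mu h -> L2norm mu (A h) <= rho * L2norm mu h.
Proof.
move=> lam_ge0 lam_lt1 rho_gt0 rho_max [g [mg hg gfin]].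
pose u1 x := Remx (g x); pose u2 x := Immx (g x).
have mu1 a : measurable_fun setT (fun x => u1 x a 0).
  by under eq_fun do rewrite mxE; have [] := mg a.
have mu2 a : measurable_fun setT (fun x => u2 x a 0).
  by under eq_fun do rewrite mxE; have [] := mg a.
have mdot (u : X -> 'cV[R]_(d * d)) : (forall a, measurable_fun setT (fun x => u x a 0)) ->
    measurable_fun setT (fun x => dotv (u x) (u x)).
  move=> mu_; under eq_fun do rewrite dotvE.
  by apply: measurable_sum => a; exact: measurable_funM.
pose phi x := dotv (u1 x) (u1 x) + dotv (u2 x) (u2 x).
have mphi : measurable_fun setT phi by apply: measurable_funD; exact: mdot.
have iphi : mu.-integrable setT (EFin \o phi).
  apply/integrableP; split; first exact/measurable_EFinP.
  under eq_integral => x _ do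
    rewrite /= /phi /u1 /u2 ger0_norm ?addr_ge0 ?dotv_ge0 // -cdotE.
  exact: gfin.
have iuu1 : mu.-integrable setT (EFin \o (fun x => dotv (u1 x) (u1 x))).
  apply: (le_integrable _ _ _ iphi) => //; first by apply/measurable_EFinP; exact: mdot.
  move=> x _ /=; rewrite lee_fin !ger0_norm ?addr_ge0 ?dotv_ge0 //.
  by rewrite lerDl dotv_ge0.
have iuu2 : mu.-integrable setT (EFin \o (fun x => dotv (u2 x) (u2 x))).
  apply: (le_integrable _ _ _ iphi) => //; first by apply/measurable_EFinP; exact: mdot.
  move=> x _ /=; rewrite lee_fin !ger0_norm ?addr_ge0 ?dotv_ge0 //.
  by rewrite lerDr dotv_ge0.
have iu1 a := integrable_coord (mu1 a) iuu1.
have iu2 a := integrable_coord (mu2 a) iuu2.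
pose w := weighted_mean h.
(* Handles both parts at once, [e] being the real or the imaginary part and [u] the matching part of
   [g]. The measurable function [f] stands in for a coordinate of S h. *)
have meanE (u : X -> 'cV[R]_(d * d)) (e : R[i] -> R) :
    (forall a, mu.-integrable setT (EFin \o (fun x => u x a 0))) ->
    (forall x j a, F x = B j -> h x = g x ->
       e ((expT F (theta / 2) x *m h x) a 0) = (S j *m u x) a 0) ->
    \col_a Rintegral mu setT (fun x => e ((expT F (theta / 2) x *m h x) a 0)) =
    \sum_j S j *m cell_integral mu F B u j.
  move=> iu eE; apply/colP => a; rewrite mxE summxE.
  pose f x := \sum_j \sum_b S j a b * (ind j x * u x b 0).
  have ifj j : mu.-integrable setT (EFin \o
      (fun x => \sum_b S j a b * (ind j x * u x b 0))).
    by apply: integrable_sumr => b; apply: integrableZr; exact: integrable_cell_indic.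
  rewrite (@ae_eq_Rintegral _ _ _ _ _ f).
  - rewrite Rintegral_sum //; apply: eq_bigr => j _.
    rewrite Rintegral_sum; last first.
      by move=> b; apply: integrableZr; exact: integrable_cell_indic.
    rewrite mxE; apply: eq_bigr => b _.
    by rewrite RintegralZl ?mxE //; exact: integrable_cell_indic.
  - by apply: measurable_of_integrable; exact: integrable_sumr.
  apply/ae_cellP; apply: filterS hg => x hgx j Fx; rewrite (eE _ _ _ Fx hgx).
  rewrite /f (bigD1 j) //= [X in _ + X]big1 ?addr0 => [|i /negbTE ij].
    by rewrite mxE; apply: eq_bigr => b _; rewrite (cell_indicE F_simple _ Fx) eqxx mul1r.
  by rewrite big1 // => b _; rewrite (cell_indicE F_simple _ Fx) ij mul0r mulr0.
have RewE : Remx w = \sum_j S j *m cell_integral mu F B u1 j.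
  rewrite -(meanE _ (@complex.Re R)) //.
    by apply/colP => a; rewrite !mxE.
  by move=> x j a Fx hgx; rewrite (expT_halfE Fx) hgx -Remx_mul [RHS]mxE.
have ImwE : Immx w = \sum_j S j *m cell_integral mu F B u2 j.
  rewrite -(meanE _ (@complex.Im R)) //.
    by apply/colP => a; rewrite !mxE.
  by move=> x j a Fx hgx; rewrite (expT_halfE Fx) hgx -Immx_mul [RHS]mxE.
have [g1 [ig1 g1_le g1P]] := cell_tangent_bound F_simple sym_expmx_kron lam_ge0 lam_lt1
  rho_gt0 rho_max iu1 iuu1 RewE.
have [g2 [ig2 g2_le g2P]] := cell_tangent_bound F_simple sym_expmx_kron lam_ge0 lam_lt1
  rho_gt0 rho_max iu2 iuu2 ImwE.
have normAh : Rintegral mu setT (fun x => complex.Re (cdot (A h x) (A h x))) <=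
    rho ^+ 2 * Rintegral mu setT phi.
  apply: (@le_trans _ _ (Rintegral mu setT (fun x => g1 x + g2 x))).
    apply: ge0_ae_le_Rintegral.
    - by move=> x; rewrite cdotE addr_ge0 ?dotv_ge0.
    - exact: integrableDr.
    apply/ae_cellP; apply: filterS hg => x hgx j Fx; rewrite cdotE lerD //.
      apply: (g1P x j) => //.
      by rewrite (perturbed_opE _ Fx) RemxD !RemxZr !Remx_mul hgx.
    apply: (g2P x j) => //.
    by rewrite (perturbed_opE _ Fx) ImmxD !ImmxZr !Immx_mul hgx.
  by rewrite RintegralD // /phi RintegralD // mulrDr lerD.
have normh : Rintegral mu setT (fun x => complex.Re (cdot (h x) (h x))) =
    Rintegral mu setT phi.
  by apply: ae_eq_Rintegral => //; apply: filterS hg => x ->; rewrite cdotE.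
rewrite /L2norm /L2inner /= normh -[X in X * _](ger0_norm (ltW rho_gt0)) -sqrtr_sqr.
rewrite -sqrtrM ?sqr_ge0 //; exact: ler_wsqrtr.
Qed.

End PerturbedOperator.

(** * Logarithmic growth rate and assembly of the result *)

Lemma cvg_ln_geometric (R : realType) (Q : nat -> R) (c C rho : R) :
  0 < rho -> 0 < c -> (forall N, c * rho ^+ N <= Q N <= C * rho ^+ N) ->
  (fun n => n%:R^-1 * ln (Q n.-1)) @ \oo --> ln rho.
Proof.
move=> rho0 c0 Qb.
have C0 : 0 < C.
  have /andP[h1 h2] := Qb 0; rewrite expr0 !mulr1 in h1 h2.
  exact: lt_le_trans c0 (le_trans h1 h2).
(* The shift drops n = 0 and sets [Q n] against the factor 1/(n+1); by [lnE] the mismatch with rho^n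
   costs only a term of order 1/(n+1). *)
rewrite -(cvg_shiftS _).
have lim a : (fun n => ln rho + (a - ln rho) * n.+1%:R^-1) @ \oo --> ln rho.
  rewrite -[X in _ --> X]addr0 -[X in _ --> _ + X](mulr0 (a - ln rho)).
  apply: cvgD; first exact: cvg_cst.
  by apply: cvgM; [exact: cvg_cst|exact: cvg_harmonic].
have lnE a n : 0 < a -> n.+1%:R^-1 * ln (a * rho ^+ n) =
    ln rho + (ln a - ln rho) * n.+1%:R^-1.
  move=> a0; rewrite lnM ?posrE ?exprn_gt0 // lnXn // -mulr_natr.
  have : n.+1%:R != 0 :> R by rewrite pnatr_eq0.
  by rewrite -natr1 => n0; field.
apply: (@squeeze_cvgr _ _ _ _ (fun n => n.+1%:R^-1 * ln (c * rho ^+ n))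
  (fun n => n.+1%:R^-1 * ln (C * rho ^+ n))).
- apply: nearW => n /=; have /andP[h1 h2] := Qb n.
  have Q0 : 0 < Q n by apply: lt_le_trans h1; rewrite mulr_gt0 ?exprn_gt0.
  by rewrite !ler_pM2l ?invr_gt0 ?ltr0n // !ler_ln ?posrE ?mulr_gt0 ?exprn_gt0 ?h1.
- by under eq_fun do rewrite lnE //; exact: lim.
- by under eq_fun do rewrite lnE //; exact: lim.
Qed.

Lemma exists_cellwise (T I : Type) (J : finType) (C : eqType) (F : T -> C) (B : J -> C)
    (k : J -> I) (k0 : I) : injective B ->
  exists h : T -> I, forall x j, F x = B j -> h x = k j.
Proof.
move=> B_inj; exists (fun x => if [pick j | F x == B j] is Some j then k j else k0).
move=> x j Fx; case: pickP => [i /eqP Fxi|/(_ j)]; last by rewrite Fx eqxx.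
by rewrite (B_inj i j) // -Fxi.
Qed.

(** For an eigenvector u of [B], the tensor u (x) u, entered as vec(u u^T), is an eigenvector of
    both summands of [kron_avg B]. [eigenvalue] speaks of row vectors, whence the transpose. *)
Lemma expmx_kron_eigen (R : realType) d (B : 'M[R]_d) b s : B^T = B -> eigenvalue B b ->
  exists2 y : 'cV[R]_(d * d), y != 0 &
    expmx (s *: kron_avg B) *m y = expR (s * b) *: y.
Proof.
move=> symB /eigenvalueP[v vB v0]; pose u := v^T.
have Bu : B *m u = b *: u by rewrite -[B]symB -trmx_mul vB linearZ.
exists (vec (u *m u^T)).
  apply/eqP => /(congr1 (@unvec _ _)); rewrite vecK => uu.
  have [a va] : exists a, v 0 a != 0.
    by apply/rV0Pn.
  move/matrixP/(_ a a) : uu; rewrite !mxE big_ord1 !mxE => /eqP.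
  by rewrite mulf_eq0 orbb (negbTE va).
apply: expmx_eigen; first by rewrite linearZ /= tr_kron_avg.
rewrite -scalemxAl /kron_avg -scalemxAl mulmxDl !tens_vec trmx1 mul1mx mulmx1.
have -> : u *m u^T *m B^T = b *: (u *m u^T).
  by rewrite -mulmxA -trmx_mul Bu linearZ /= scalemxAr.
rewrite mulmxA Bu -scalemxAl -scalerA; congr (_ *: _).
by apply/colP => a; rewrite !mxE; field.
Qed.

(** [largest_eigenvalue] determines [rho] uniquely. Positivity of [q n] in [R[i]] says that it is
    real and positive, so the logarithm of its real part is a genuine one. *)
Theorem lemma5p5 (dX : measure_display) (X : measurableType dX) (R : realType)
    (mu : probability X R) (d m : nat) (lam theta a b : R)
    (F : X -> 'M[R]_d) (B : 'I_m -> 'M[R]_d)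
    (lam_ge0 : 0 <= lam) (lam_lt1 : lam < 1) (theta_gt0 : 0 < theta)
    (F_simple : ae_simple mu F B)
    (B_bounds : forall j, loewner_le a%:M (B j) /\ loewner_le (B j) b%:M)
    (B_tight : tight_bounds B a b) :
  let A := perturbed_op mu F lam theta in
  let u := fun=> vec 1%:M : 'cV[R[i]]_(d * d) in
  let E := mulop (expT F (theta / 2)) in
  let q := fun n : nat => L2inner mu u (E (iter n.-1 A (E u))) in
  (* (1) *)
  (forall (r : R[i]) (v : 'cV[R[i]]_(d * d)),
     calF_defined mu F lam theta r ->
     v != 0 -> calF mu F lam theta r *m v = v ->
     eigenfunction mu A r (calF_eigenfunction F lam theta r v)) /\
  (forall (r : R[i]) (h : X -> 'cV[R[i]]_(d * d)),
     calF_defined mu F lam theta r -> eigenfunction mu A r h ->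
     exists v : 'cV[R[i]]_(d * d),
       [/\ v != 0, calF mu F lam theta r *m v = v &
           ae_equal mu h (calF_eigenfunction F lam theta r v)]) /\
  (exists rho : R,
     [/\ largest_eigenvalue mu A rho,
         (* (2) *)
         lam * expR (theta * b) < rho,
         (* (3) *)
         L2opnorm mu A = rho,
         (forall n : nat, (0 < n)%N -> 0 < q n) &
         (fun n : nat => n%:R^-1 * ln (complex.Re (q n))) @ \oo --> ln rho /\
         ln rho = ln (L2opnorm mu A)]).
Proof.
move=> A u E q; split; first by move=> r v; exact: (calF_eigenvector_eigenfunction F_simple).
split; first by move=> r h; exact: (eigenfunction_calF F_simple).
have [B_inj Bsym _ _ _] := F_simple.
pose p := cell_prob mu F B; pose S j := expmx ((theta / 2) *: kron_avg (B j)).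
have p_gt0 j : 0 < p j by exact: cell_prob_gt0 F_simple j.
have symS j : (S j)^T = S j by exact: sym_expmx_kron F_simple j.
have [_ [j0 Bb] _] := B_tight.
have m0 : (0 < m)%N by exact: leq_ltn_trans (ltn_ord j0).
have [y y0 Sy] := expmx_kron_eigen (theta / 2) (Bsym j0) Bb.
have n0 : (0 < d * d)%N.
  by rewrite lt0n; apply: contra_neq y0 => n0; apply/colP => i;
    suff: (i < 0)%N by []; rewrite -[X in (_ < X)%N]n0.
have [rho [k [[j kj] opk rho_max]]] := cell_op_top lam p_gt0 symS m0 n0.
have rho_gt : lam * expR (theta * b) < rho.
  (* [y] is an eigenvector of S_j0 for e^(theta b / 2), so |S_j0 y|^2 = e^(theta b) |y|^2. *)
  have Sy0 : S j0 *m y != 0 by rewrite Sy scaler_eq0 negb_or gt_eqF ?expR_gt0.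
  have := cell_top_gt p_gt0 symS lam_lt1 rho_max Sy0.
  rewrite Sy dotvZl dotvZr !mulrA ltr_pM2r ?dotv_gt0 // -mulrA -expRD.
  by rewrite -mulrDl -splitr.
have rho0 : 0 < rho by apply: le_lt_trans rho_gt; rewrite mulr_ge0 ?expR_ge0.
pose op := cell_op p S lam.
have kk0 := cell_dot_gt0 p_gt0 kj.
(* Normalized so that the function [h] built from it has norm 1: [h] attains the operator norm and
   is also the eigenfunction for [rho]. *)
pose k1 i := (Num.sqrt (cell_dot p k k))^-1 *: k i.
have k1E : cell_dot p k1 k1 = 1.
  rewrite cell_dotZ exprVn sqr_sqrtr ?mulVf ?gt_eqF //; exact: ltW.
have opk1 i : op k1 i = rho *: k1 i.
  by rewrite /op /k1 cell_opZ opk !scalerA mulrC.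
have [h hE] := exists_cellwise F (fun i => complexify (k1 i)) 0 B_inj.
have h_cell : {ae mu, forall x i, F x = B i -> h x = complexify (k1 i)}.
  by apply: nearW => x i; exact: hE.
have Ah_cell : {ae mu, forall x i, F x = B i -> A h x = complexify (rho *: k1 i)}.
  apply: filterS (perturbed_op_cell lam theta F_simple h_cell) => x H i Fx.
  by rewrite -opk1; exact: H.
have L2h : L2 mu h by exact: (L2_cell F_simple h_cell).
have normh : L2norm mu h = 1.
  by rewrite /L2norm (L2inner_cell F_simple h_cell h_cell) -/p k1E sqrtr1.
have normAh : L2norm mu (A h) = rho.
  rewrite /L2norm (L2inner_cell F_simple Ah_cell Ah_cell) -/p /=.
  by rewrite cell_dotZ k1E mulr1 sqrtr_sqr gtr0_norm.
have norm_le f : L2 mu f -> L2norm mu (A f) <= rho * L2norm mu f.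
  exact: (L2norm_op_le F_simple).
have opnormE : L2opnorm mu A = rho.
  have ub : ubound [set L2norm mu (A f) | f in [set f | L2 mu f /\ L2norm mu f <= 1]] rho.
    move=> _ [f [L2f f1] <-]; apply: le_trans (norm_le _ L2f) _.
    by rewrite ger_pMr.
  have Ah_in : [set L2norm mu (A f) | f in [set f | L2 mu f /\ L2norm mu f <= 1]] rho.
    by exists h; rewrite //= normh.
  apply/eqP; rewrite eq_le; apply/andP; split.
    by apply: ge_sup => //; exists rho.
  by apply: ub_le_sup => //; exists rho.
pose g i := S i *m vec 1%:M.
have vec1 : complexify (vec (1%:M : 'M[R]_d)) = vec 1%:M.
  by apply/colP => i; rewrite !mxE rmorph_nat.
have iterE N : {ae mu, forall x i, F x = B i -> iter N A (E u) x = complexify (iter N op g i)}.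
  elim: N => [|N IH] /=; last exact: (perturbed_op_cell lam theta F_simple IH).
  apply: nearW => x i Fx; rewrite /E /mulop (expT_halfE _ Fx) /g.
  by rewrite /complexify map_mxM -/(complexify (vec _)) vec1.
pose Q N := cell_dot p g (iter N op g).
(* By symmetry of [S] the outer [E] moves onto [u], which leaves <g, A^(n-1) g>. *)
have qE n : q n = (Q n.-1)%:C.
  rewrite /q (L2inner_cell F_simple (k := fun=> vec 1%:M)
    (k' := fun i => S i *m iter n.-1 op g i)).
  - congr (_%:C); apply: eq_bigr => i _; rewrite dotv_sym //.
  - by apply: nearW => x i _; rewrite vec1.
  apply: filterS (iterE n.-1) => x H i Fx.
  by rewrite /E /mulop (expT_halfE _ Fx) (H _ Fx) /complexify map_mxM.
(* The exponent is theta/4: [expmx_kron_avg] halves the theta/2 in [S] once more, which gives S_i =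
   K_i (x) K_i. *)
pose K i := expmx ((theta / 2 / 2) *: B i).
have symsB s i : (s *: B i)^T = s *: B i by rewrite linearZ /= Bsym.
have SK : S = fun i => K i *t K i by apply/funext => i; exact: expmx_kron_avg.
have [c c0 Q_ge] : exists2 c : R, 0 < c & forall N, c * rho ^+ N <= Q N.
  have symK i : (K i)^T = K i by exact: tr_expmx.
  have unitK i : K i \in unitmx by exact: expmx_unit.
  rewrite /Q /g /op SK.
  apply: (cell_iter_growth p_gt0 symK unitK lam_ge0 lam_lt1 rho0 kj) => i.
  by rewrite -SK.
have Q_le N : Q N <= cell_dot p g g * rho ^+ N.
  apply: cell_iter_le => // k'.
  exact: (cell_op_norm_le p_gt0 symS lam_ge0 lam_lt1 rho_max rho0).
exists rho; split => //.
- split; last exact: (eigenvalue_le_top F_simple lam_ge0 lam_lt1 rho0 rho_max).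
  exists h; split => //.
    move=> h0; have := normh; rewrite /L2norm (L2inner_cell F_simple (k := fun=> 0) (k' := fun=> 0)).
    + rewrite /cell_dot big1 ?sqrtr0 => [|i _]; last by rewrite dotv0r mulr0.
      by move/eqP; rewrite eq_sym oner_eq0.
    + by apply: filterS h0 => x -> i _; rewrite /complexify map_mx0.
    + by apply: filterS h0 => x -> i _; rewrite /complexify map_mx0.
  apply/(ae_cellP F_simple); apply: filterS Ah_cell => x H i Fx.
  by rewrite (H _ Fx) (hE _ _ Fx) /complexify map_mxZ.
- move=> n _; rewrite qE ltcR; apply: lt_le_trans (Q_ge _).
  by rewrite mulr_gt0 ?exprn_gt0.
split; last by rewrite opnormE.
under eq_fun do rewrite qE /=.
by apply: (cvg_ln_geometric rho0 c0) => N; rewrite Q_ge; exact: Q_le.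
Qed.
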